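(* Let $(\mathbb{U}_p)_{p\in P}$ and $(\mathbb{V}_p)_{p\in P}$ be families of separable real Hilbert spaces for which there exist fundamental sequences of $\mu$-measurable sections $(\phi_n)_{n\in\mathbb{N}}$ in $\prod_{p\in P}\mathbb{U}_p$ and $(\psi_n)_{n\in\mathbb{N}}$ in $\prod_{p\in P}\mathbb{V}_p$. For each $p\in P$ let $b(\cdot,\cdot;p):\mathbb{U}_p\times\mathbb{V}_p\to\mathbb{R}$ be a bounded bilinear form such that for all $n,m\in\mathbb{N}$ the mapping $P\ni p\mapsto b(\phi_n(p),\psi_m(p);p)$ is measurable. Let $\mathbb{X}=L_2\bigl(P,(\mathbb{U}_p)_{p\in P}\bigr)$, $\mathbb{Y}=L_2\bigl(P,(\mathbb{V}_p)_{p\in P}\bigr)$ be the corresponding direct integrals and let $\mathcal{B}$ be defined by $$(\mathcal{B}w)(v)=b(w,v):=\int_P b\bigl(w(p),v(p);p\bigr)\,d\mu(p),\qquad w\in\mathbb{X},\ v\in\mathbb{Y}.$$ Then $\mathcal{B}:\mathbb{X}\to\mathbb{Y}'$ is an isomorphism if and only if there exist constants $c_b,C_b>0$, independent of $p$, such that for $\mu$-almost all $p\in P$ $$\sup_{w\in\mathbb{U}_p}\sup_{v\in\mathbb{V}_p}\frac{b(w,v;p)}{\|w\|_{\mathbb{U}_p}\|v\|_{\mathbb{V}_p}}\le C_b,\qquad \inf_{w\in\mathbb{U}_p}\sup_{v\in\mathbb{V}_p}\frac{b(w,v;p)}{\|w\|_{\mathbb{U}_p}\|v\|_{\mathbb{V}_p}}\ge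 c_b,$$ and for each $0\ne v\in\mathbb{V}_p$ there exists $w_v\in\mathbb{U}_p$ such that $b(w_v,v;p)\ne0$. In this case, with the same constants $c_b,C_b$, $$\sup_{w\in\mathbb{X}}\sup_{v\in\mathbb{Y}}\frac{b(w,v)}{\|w\|_{\mathbb{X}}\|v\|_{\mathbb{Y}}}\le C_b,\qquad \inf_{w\in\mathbb{X}}\sup_{v\in\mathbb{Y}}\frac{b(w,v)}{\|w\|_{\mathbb{X}}\|v\|_{\mathbb{Y}}}\ge c_b,$$ and for each $0\ne v\in\mathbb{Y}$ there exists $w_v\in\mathbb{X}$ such that $b(w_v,v)\neq 0$.
   Context: $P$ is a parameter domain endowed with a probability measure $\mu$. Suprema and infima are over nonzero elements. Direct integrals. For a family $(\mathbb{W}_p)_{p\in P}$ of separable Hilbert spaces, a sequence $(\xi_n)_{n\in\mathbb{N}}$ in $\prod_{p\in P}\mathbb{W}_p$ is a fundamental sequence of $\mu$-measurable sections if for all $n,m$ the function $p\mapsto\langle\xi_n(p),\xi_m(p)\rangle_{\mathbb{W}_p}$ is $\mu$-measurable and for each $p\in P$ the finite linear combinations of the $\xi_n(p)$, $n\in\mathbb{N}$, are dense in $\mathbb{W}_p$. Given such a sequence, $v\in\prod_{p\in P}\mathbb{W}_p$ is called $\mu$-measurable if $p\mapsto\langle v(p),\xi_n(p)\rangle_{\mathbb{W}_p}$ is $\mu$-measurable for all $n$. The direct integral $L_2(P,(\mathbb{W}_p)_{p\in P})$ is the Hilbert space of all $\mu$-measurable $v\in\prod_{p\in P}\mathbb{W}_p$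 with $\int_P\|v(p)\|_{\mathbb{W}_p}^2\,d\mu(p)<\infty$ (elements agreeing $\mu$-a.e. identified), with inner product $\langle v,w\rangle=\int_P\langle v(p),w(p)\rangle_{\mathbb{W}_p}\,d\mu(p)$. Here measurability in $\mathbb{X}$ and $\mathbb{Y}$ is with respect to $(\phi_n)_{n\in\mathbb{N}}$ and $(\psi_n)_{n\in\mathbb{N}}$, respectively. ''$\mathcal{B}:\mathbb{X}\to\mathbb{Y}'$ is an isomorphism'' means that the integral defining $b(w,v)$ exists for all $w\in\mathbb{X}$, $v\in\mathbb{Y}$, that $\mathcal{B}$ is a bounded linear map from $\mathbb{X}$ to $\mathbb{Y}'$, and that $\mathcal{B}$ is bijective with bounded inverse. *)

(* Defs.v *)
From HB Require Import structures.
From mathcomp Require Import all_boot all_order all_algebra.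
From mathcomp Require Import all_classical all_reals all_analysis.
From mathcomp Require Import measurable_realfun generic_quotient.
From mathcomp Require Import ring lra.

Set Implicit Arguments.
Unset Strict Implicit.
Unset Printing Implicit Defensive.

Import Order.TTheory GRing.Theory Num.Theory.
Import numFieldNormedType.Exports.

Local Open Scope classical_set_scope.
Local Open Scope ring_scope.

HB.mixin Record NormedModule_isPreHilbert (R : realType) V
    & NormedModule R V := {
  inner : V -> V -> R;
  innerC : forall u v, inner u v = inner v u;
  innerDl : forall u v w, inner (u + v) w = inner u w + inner v w;
  innerZl : forall (a : R) u v, inner (a *: u) v = a * inner u v;
  inner_normE : forall u, inner u u = `|u| ^+ 2
}.

#[short(type="preHilbertType")]
HB.structure Definition PreHilbert (R : realType) :=
  {V of NormedModule R V & NormedModule_isPreHilbert R V}.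

#[short(type="hilbertType")]
HB.structure Definition Hilbert (R : realType) :=
  {V of PreHilbert R V & CompleteNormedModule R V}.

HB.factory Record Lmodule_isPreHilbert (R : realType) V & GRing.Lmodule R V := {
  inner : V -> V -> R;
  innerC : forall u v, inner u v = inner v u;
  innerDl : forall u v w, inner (u + v) w = inner u w + inner v w;
  innerZl : forall (a : R) u v, inner (a *: u) v = a * inner u v;
  inner_ge0 : forall u, 0 <= inner u u;
  inner_eq0 : forall u, inner u u = 0 -> u = 0
}.

HB.builders Context R V & Lmodule_isPreHilbert R V.

Let norm (u : V) : R := Num.sqrt (inner u u).

Let innerDr u v w : inner u (v + w) = inner u v + inner u w.
Proof. by rewrite innerC innerDl !(innerC u). Qed.

Let innerZr a u v : inner u (a *: v) = a * inner u v.
Proof. by rewrite innerC innerZl (innerC u). Qed.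

Let sqr_norm u : norm u ^+ 2 = inner u u.
Proof. by rewrite sqr_sqrtr ?inner_ge0. Qed.

Let norm_ge0 u : 0 <= norm u. Proof. exact: sqrtr_ge0. Qed.

Let normr0_eq0 u : norm u = 0 -> u = 0.
Proof. by move=> u0; apply: inner_eq0; rewrite -sqr_norm u0 expr0n. Qed.

Let normZ (a : R) u : norm (a *: u) = `|a| * norm u.
Proof.
by rewrite /norm innerZl innerZr mulrA -expr2 sqrtrM ?sqr_ge0// sqrtr_sqr.
Qed.

Let cauchy_schwarz u v : inner u v <= norm u * norm v.
Proof.
have [u0|u0] := eqVneq (norm u) 0.
  rewrite u0 mul0r (normr0_eq0 u0).
  by rewrite -[0 : V](scale0r (0 : V)) innerZl mul0r.
have [v0|v0] := eqVneq (norm v) 0.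
  rewrite v0 mulr0 (normr0_eq0 v0).
  by rewrite -[0 : V](scale0r (0 : V)) innerZr mul0r.
have nu : 0 < norm u by rewrite lt_def u0 norm_ge0.
have nv : 0 < norm v by rewrite lt_def v0 norm_ge0.
have := inner_ge0 (norm v *: u + (- norm u) *: v).
rewrite !(innerDl, innerDr, innerZl, innerZr) -!sqr_norm (innerC v u) => h.
have h2 : 0 <= (2 * (norm u * norm v)) * (norm u * norm v - inner u v).
  by apply: le_trans h _; rewrite le_eqVlt; apply/orP; left; apply/eqP; ring.
by move: h2; rewrite pmulr_rge0 ?subr_ge0// mulr_gt0// mulr_gt0.
Qed.

Let normD u v : norm (u + v) <= norm u + norm v.
Proof.
rewrite -(@ler_pXn2r _ 2%N)// ?nnegrE ?addr_ge0 ?norm_ge0//.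
rewrite sqr_norm sqrrD !sqr_norm innerDl !innerDr (innerC v u).
by have := cauchy_schwarz u v; rewrite mulr2n; lra.
Qed.

HB.instance Definition _ := Lmodule_isNormed.Build R V normD normZ normr0_eq0.

Let inner_normE u : inner u u = `|u| ^+ 2. Proof. by rewrite -sqr_norm. Qed.

HB.instance Definition _ :=
  NormedModule_isPreHilbert.Build R V innerC innerDl innerZl inner_normE.

HB.end.

Section inner_theory.
Context {R : realType} {V : preHilbertType R}.
Implicit Types u v w : V.

Lemma innerDr u v w : inner u (v + w) = inner u v + inner u w.
Proof. by rewrite innerC innerDl !(innerC u). Qed.

Lemma innerZr (a : R) u v : inner u (a *: v) = a * inner u v.
Proof. by rewrite innerC innerZl (innerC u). Qed.

Lemma inner0l v : inner 0 v = 0.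
Proof. by rewrite -(scale0r (0 : V)) innerZl mul0r. Qed.

Lemma inner0r v : inner v 0 = 0. Proof. by rewrite innerC inner0l. Qed.

Lemma innerNl u v : inner (- u) v = - inner u v.
Proof. by rewrite -scaleN1r innerZl mulN1r. Qed.

Lemma innerNr u v : inner u (- v) = - inner u v.
Proof. by rewrite innerC innerNl innerC. Qed.

Lemma inner_suml I (r : seq I) (F : I -> V) v :
  inner (\sum_(i <- r) F i) v = \sum_(i <- r) inner (F i) v.
Proof.
elim: r => [|i r ih]; first by rewrite !big_nil inner0l.
by rewrite !big_cons innerDl ih.
Qed.

Lemma inner_sumr I (r : seq I) (F : I -> V) v :
  inner v (\sum_(i <- r) F i) = \sum_(i <- r) inner v (F i).
Proof. by rewrite innerC inner_suml; apply: eq_bigr => i _; rewrite innerC. Qed.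

Lemma sqr_normD u v : `|u + v| ^+ 2 = `|u| ^+ 2 + 2 * inner u v + `|v| ^+ 2.
Proof. by rewrite -!inner_normE innerDl !innerDr (innerC v u); ring. Qed.

Lemma sqr_normB u v : `|u - v| ^+ 2 = `|u| ^+ 2 - 2 * inner u v + `|v| ^+ 2.
Proof. by rewrite sqr_normD innerNr normrN; ring. Qed.

Lemma inner_polar u v :
  inner u v = 2^-1 * (`|u + v| ^+ 2 - `|u| ^+ 2 - `|v| ^+ 2).
Proof. by rewrite sqr_normD; field. Qed.

Lemma normr_inner_le u v : `|inner u v| <= `|u| ^+ 2 + `|v| ^+ 2.
Proof.
have := sqr_ge0 `|u + v|; have := sqr_ge0 `|u - v|.
have := sqr_ge0 `|u|; have := sqr_ge0 `|v|.
by rewrite sqr_normB sqr_normD ler_norml => *; apply/andP; split; lra.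
Qed.

End inner_theory.

Definition separable (T : topologicalType) :=
  exists2 D : set T, countable D & dense D.

Definition lin_span (R : realType) (V : normedModType R) (e : nat -> V) : set V :=
  [set x | exists n (a : nat -> R), x = \sum_(i < n) a i *: e i].

Section sections.
Context {d : measure_display} {P : measurableType d} {R : realType}.
Context {W : P -> hilbertType R}.
Implicit Type phi : nat -> forall p, W p.

Definition fundamental_sequence phi :=
  (forall n m, measurable_fun [set: P] (fun p => inner (phi n p) (phi m p))) /\
  (forall p, dense (lin_span (fun n => phi n p))).

Definition measurable_section phi (v : forall p, W p) :=
  forall n, measurable_fun [set: P] (fun p => inner (v p) (phi n p)).

Section measurability.
Context {phi : nat -> forall p, W p} (hphi : fundamental_sequence phi).

Let rcomb (s : seq rat) (p : P) : W p :=
  \sum_(i < size s) ratr (nth 0 s i) *: phi i p.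

Let rcomb_dense p (x : W p) (e : R) : 0 < e ->
  exists s, `|x - rcomb s p| < e.
Proof.
move=> e0; have e20 : 0 < e / 2 by rewrite divr_gt0.
have [y [By [n [a ya]]]] :
    ball x (e / 2) `&` lin_span (fun n => phi n p) !=set0.
  apply: hphi.2; first by exists x; exact: ballxx.
  exact: ball_open.
pose c i := e / 2 / n.+1%:R / (1 + `|phi i p|).
have c0 i : 0 < c i by rewrite !divr_gt0 ?ltr0n ?ltr_pwDl.
have /choice[r rP] (i : nat) : exists r : rat, `|a i - ratr r| < c i.
  have [x' [+ [r _ rx]]] : ball (a i) (c i) `&` range (@ratr R) !=set0.
    apply: dense_rat; first by exists (a i); exact: ballxx.
    exact: ball_open.
  by rewrite -ball_normE => ?; exists r; rewrite rx.
exists (mkseq r n).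
have -> : rcomb (mkseq r n) p = \sum_(i < n) ratr (r i) *: phi i p.
  rewrite /rcomb size_mkseq; apply: eq_bigr => i _.
  by rewrite nth_mkseq.
rewrite (splitr e) -(subrKA y) (le_lt_trans (ler_normD _ _))// ltrD//.
  by move: By; rewrite -ball_normE.
rewrite ya -sumrB (le_lt_trans (ler_norm_sum _ _ _))//.
apply: (@le_lt_trans _ _ (\sum_(i < n) e / 2 / n.+1%:R)).
  apply: ler_sum => i _; rewrite -scalerBl normrZ.
  apply: (@le_trans _ _ (c i * `|phi i p|)).
    by rewrite ler_wpM2r// ltW.
  rewrite /c -mulrA ler_piMr//; first by rewrite ltW// divr_gt0.
  by rewrite mulrC ler_pdivrMr ?ltr_pwDl// mul1r lerDr.
rewrite sumr_const card_ord -[X in X < _]mulr_natr -mulrA gtr_pMr//.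
by rewrite mulrC ltr_pdivrMr// mul1r ltr_nat.
Qed.

Lemma measurable_sqr_norm v : measurable_section phi v ->
  measurable_fun [set: P] (fun p => `|v p| ^+ 2).
Proof.
move=> mv.
pose y n p := rcomb (odflt [::] (unpickle n)) p.
pose h n p := 2 * inner (v p) (y n p) - inner (y n p) (y n p).
have hE n p : h n p = `|v p| ^+ 2 - `|v p - y n p| ^+ 2.
  by rewrite /h sqr_normB inner_normE; ring.
have hub p : ubound (range (h ^~ p)) (`|v p| ^+ 2).
  by move=> _ [n _ <-]; rewrite hE gerBl sqr_ge0.
have -> : (fun p => `|v p| ^+ 2) = (fun p => sups (h ^~ p) 0).
  apply/funext => p; apply/eqP; rewrite eq_le; apply/andP; split; last first.
    apply: ge_sup; first by exists (h 0%N p); exists 0%N.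
    by move=> _ [n _ <-]; apply: (hub p); exists n.
  apply/ler_addgt0Pr => e e0.
  have [s sP] := @rcomb_dense p (v p) (Num.sqrt e) (ltac:(by rewrite sqrtr_gt0)).
  have : h (pickle s) p <= sups (h ^~ p) 0.
    apply: ub_le_sup; last by exists (pickle s).
    by exists (`|v p| ^+ 2) => _ [n _ <-]; apply: (hub p); exists n.
  rewrite hE /y pickleK/= => H.
  have : `|v p - rcomb s p| ^+ 2 < e.
    rewrite -[ltRHS](sqr_sqrtr (ltW e0)).
    by rewrite ltr_pXn2r ?nnegrE ?sqrtr_ge0.
  by move: H; lra.
apply: measurable_fun_sups => [p _|n]; first by exists (`|v p| ^+ 2); exact: hub.
apply: measurable_funB.
  apply: measurable_funM; first exact: measurable_cst.
  rewrite /y /rcomb; under eq_fun do rewrite inner_sumr.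
  apply: measurable_sum => i; under eq_fun do rewrite innerZr.
  by apply: measurable_funM; [exact: measurable_cst|exact: mv].
rewrite /y /rcomb; under eq_fun do rewrite inner_sumr.
apply: measurable_sum => i; under eq_fun do rewrite inner_suml.
apply: measurable_sum => j; under eq_fun do rewrite innerZr innerZl.
by do 2 (apply: measurable_funM; first exact: measurable_cst); exact: hphi.1.
Qed.

End measurability.
End sections.

Section direct_integral.
Local Open Scope quotient_scope.
Context {d : measure_display} {P : measurableType d} {R : realType}.
Variable mu : probability P R.
Context {W : P -> hilbertType R} {phi : nat -> forall p, W p}.

(* The type records hphi because closure under addition relies on it: density
   of the phi n p makes p |-> `|v p| measurable for every measurable section. *)
Record l2_section (hphi : fundamental_sequence phi) := L2Section {
  l2val :> forall p, W p;
  l2val_measurable : measurable_section phi l2val;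
  l2val_fin : (\int[mu]_p (`|l2val p| ^+ 2)%:E < +oo)%E
}.

Variable hphi : fundamental_sequence phi.
Local Notation L := (l2_section hphi).

HB.instance Definition _ := gen_eqMixin L.
HB.instance Definition _ := gen_choiceMixin L.

Lemma l2_eq (v w : L) : (forall p, v p = w p) -> v = w.
Proof.
case: v w => [v mv fv] [w mw fw] /= vw.
have {}vw : v = w by exact: functional_extensionality_dep.
by subst w; congr L2Section; exact: Prop_irrelevance.
Qed.

Lemma l2_integrable (v : L) :
  mu.-integrable [set: P] (fun p => (`|v p| ^+ 2)%:E).
Proof.
apply/integrableP; split.
  apply/measurable_EFinP.
  by apply: (measurable_sqr_norm hphi); exact: (l2val_measurable v).
rewrite (eq_integral (fun p => (`|v p| ^+ 2)%:E)); first exact: l2val_fin.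
by move=> p _; rewrite gee0_abs// lee_fin sqr_ge0.
Qed.

Let fin_le (f : P -> R) (g : P -> R) :
  mu.-integrable [set: P] (EFin \o g) -> measurable_fun [set: P] f ->
  (forall p, 0 <= f p <= g p) -> (\int[mu]_p (f p)%:E < +oo)%E.
Proof.
move=> ig mf fg.
have /integrableP[_ +] : mu.-integrable [set: P] (EFin \o f).
  apply: le_integrable ig => //; first exact/measurable_EFinP.
  move=> p _ /=; have /andP[f0 fgp] := fg p.
  by rewrite lee_fin !ger0_norm// (le_trans f0).
congr (_ < _)%E; apply: eq_integral => p _.
by rewrite gee0_abs// lee_fin; case/andP: (fg p).
Qed.

Let scale_measurable (a : R) (v : L) :
  measurable_section phi (fun p => a *: v p).
Proof.
move=> n; under eq_fun do rewrite innerZl.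
apply: measurable_funM; [exact: measurable_cst|exact: l2val_measurable].
Qed.

Let add_measurable (v w : L) : measurable_section phi (fun p => v p + w p).
Proof.
by move=> n; under eq_fun do rewrite innerDl;
  apply: measurable_funD; exact: l2val_measurable.
Qed.

Let zero_measurable : measurable_section phi (fun p => 0 : W p).
Proof. by move=> n; under eq_fun do rewrite inner0l; exact: measurable_cst. Qed.

Let scale_fin (a : R) (v : L) :
  (\int[mu]_p (`|a *: v p| ^+ 2)%:E < +oo)%E.
Proof.
apply: (@fin_le _ (fun p => a ^+ 2 * `|v p| ^+ 2)).
- exact: integrableZl measurableT (a ^+ 2) _ (l2_integrable v).
- by apply: (measurable_sqr_norm hphi); exact: (scale_measurable a v).
- move=> p; rewrite sqr_ge0/= normrZ exprMn.
  by rewrite real_normK ?num_real.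
Qed.

Let add_fin (v w : L) : (\int[mu]_p (`|v p + w p| ^+ 2)%:E < +oo)%E.
Proof.
apply: (@fin_le _ (fun p => 2 * (`|v p| ^+ 2 + `|w p| ^+ 2))).
- exact: integrableZl measurableT 2 _
    (integrableD measurableT (l2_integrable v) (l2_integrable w)).
- by apply: (measurable_sqr_norm hphi); exact: (add_measurable v w).
- move=> p; rewrite sqr_ge0/=.
  by have := sqr_ge0 `|v p - w p|; rewrite sqr_normB sqr_normD; lra.
Qed.

Let zero_fin : (\int[mu]_p (`|0 : W p| ^+ 2)%:E < +oo)%E.
Proof. by under eq_integral do rewrite normr0 expr0n; rewrite integral0. Qed.

Definition l2_zero : L := @L2Section hphi (fun p => 0) zero_measurable zero_fin.
Definition l2_add (v w : L) : L :=
  @L2Section hphi (fun p => v p + w p) (add_measurable v w) (add_fin v w).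
Definition l2_scale (a : R) (v : L) : L :=
  @L2Section hphi (fun p => a *: v p) (scale_measurable a v) (scale_fin a v).

Let l2_addA : associative l2_add.
Proof. by move=> u v w; apply: l2_eq => p /=; rewrite addrA. Qed.
Let l2_addC : commutative l2_add.
Proof. by move=> u v; apply: l2_eq => p /=; rewrite addrC. Qed.
Let l2_add0 : left_id l2_zero l2_add.
Proof. by move=> u; apply: l2_eq => p /=; rewrite add0r. Qed.
Let l2_addN : left_inverse l2_zero (l2_scale (-1)) l2_add.
Proof. by move=> u; apply: l2_eq => p /=; rewrite scaleN1r addNr. Qed.

HB.instance Definition _ :=
  GRing.isZmodule.Build L l2_addA l2_addC l2_add0 l2_addN.

Let l2_scaleA a b v : l2_scale a (l2_scale b v) = l2_scale (a * b) v.
Proof. by apply: l2_eq => p /=; rewrite scalerA. Qed.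
Let l2_scale1 : left_id 1 l2_scale.
Proof. by move=> v; apply: l2_eq => p /=; rewrite scale1r. Qed.
Let l2_scaleDr : right_distributive l2_scale +%R.
Proof. by move=> a u v; apply: l2_eq => p /=; rewrite scalerDr. Qed.
Let l2_scaleDl v : {morph l2_scale^~ v : a b / a + b}.
Proof. by move=> a b; apply: l2_eq => p /=; rewrite scalerDl. Qed.

HB.instance Definition _ := GRing.Zmodule_isLmodule.Build R L
  l2_scaleA l2_scale1 l2_scaleDr l2_scaleDl.

Definition l2_ae (v w : L) : bool := `[< {ae mu, forall p, v p = w p} >].

Let l2_ae_equiv : equiv_class_of l2_ae.
Proof.
split=> [v|v w|w v u].
- by apply/asboolP; exact: aeW.
- by apply/asboolP/asboolP => vw; apply: filterS vw => p ->.
- move=> /asboolP vw /asboolP wu; apply/asboolP.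
  by apply: filterS2 vw wu => p -> ->.
Qed.

Canonical l2_ae_equivRel := EquivRelPack l2_ae_equiv.
Canonical l2_ae_encModRel := defaultEncModRel l2_ae.

Definition directIntegral := {eq_quot l2_ae}.

HB.instance Definition _ := Choice.on directIntegral.
HB.instance Definition _ := EqQuotient.on directIntegral.

Local Notation X := directIntegral.

Lemma l2_piP (v w : L) : {ae mu, forall p, v p = w p} <-> \pi_X v = \pi_X w.
Proof.
split=> [vw|/eqmodP/asboolP//]; by apply/eqmodP/asboolP.
Qed.

Lemma repr_piE (v : L) : {ae mu, forall p, (repr (\pi_X v) : L) p = v p}.
Proof. by apply/l2_piP; rewrite reprK. Qed.

Let add (x y : X) : X := \pi_X ((repr x : L) + repr y).
Let opp (x : X) : X := \pi_X (- (repr x : L)).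
Let scale (a : R) (x : X) : X := \pi_X (a *: (repr x : L)).

Let addP v w : add (\pi_X v) (\pi_X w) = \pi_X (v + w).
Proof.
by apply/l2_piP; apply: filterS2 (repr_piE v) (repr_piE w) => p /= -> ->.
Qed.
Let oppP v : opp (\pi_X v) = \pi_X (- v : L).
Proof. by apply/l2_piP; apply: filterS (repr_piE v) => p /= ->. Qed.
Let scaleP a v : scale a (\pi_X v) = \pi_X (a *: v).
Proof. by apply/l2_piP; apply: filterS (repr_piE v) => p /= ->. Qed.

Let addA : associative add.
Proof.
move=> x y z; rewrite -[x]reprK -[y]reprK -[z]reprK.
by rewrite (addP (repr y) (repr z)) (addP (repr x) (repr y)) !addP addrA.
Qed.
Let addC : commutative add.
Proof. by move=> x y; rewrite -[x]reprK -[y]reprK !addP addrC. Qed.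
Let add0 : left_id (\pi_X (0 : L)) add.
Proof. by move=> x; rewrite -[x]reprK !addP add0r. Qed.
Let addN : left_inverse (\pi_X (0 : L)) opp add.
Proof. by move=> x; rewrite -[x]reprK oppP addP addNr. Qed.

HB.instance Definition _ := GRing.isZmodule.Build X addA addC add0 addN.

Let scaleA a b v : scale a (scale b v) = scale (a * b) v.
Proof. by rewrite -[v]reprK (scaleP b) (scaleP a) scaleP scalerA. Qed.
Let scale1 : left_id 1 scale.
Proof. by move=> v; rewrite -[v]reprK scaleP scale1r. Qed.
Let scaleDr : right_distributive scale +%R.
Proof.
move=> a u v; rewrite -[u]reprK -[v]reprK [_ + _](addP (repr u) (repr v)).
by rewrite (scaleP a (repr u)) (scaleP a (repr v)) [RHS]addP scaleP scalerDr.
Qed.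
Let scaleDl v : {morph scale^~ v : a b / a + b}.
Proof.
move=> a b; rewrite -[v]reprK (scaleP a (repr v)) (scaleP b (repr v)).
by rewrite [RHS]addP scaleP scalerDl.
Qed.

HB.instance Definition _ := GRing.Zmodule_isLmodule.Build R X
  scaleA scale1 scaleDr scaleDl.

Lemma l2_piD v w : \pi_X (v + w) = \pi_X v + \pi_X w.
Proof. by rewrite [RHS]addP. Qed.

Lemma l2_piZ a v : \pi_X (a *: v) = a *: \pi_X v.
Proof. by rewrite [RHS]scaleP. Qed.

(* A chosen representative; every use below is insensitive to the choice. *)
Definition dival (x : X) : forall p, W p := repr x.
Coercion dival : directIntegral >-> Funclass.

Lemma dival_ae (x y : X) : {ae mu, forall p, x p = y p} -> x = y.
Proof. by move=> /l2_piP; rewrite !reprK. Qed.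

Lemma divalD (x y : X) : {ae mu, forall p, (x + y : X) p = x p + y p}.
Proof.
have -> : x + y = \pi_X ((repr x : L) + repr y) by rewrite l2_piD !reprK.
exact: repr_piE.
Qed.

Lemma divalZ a (x : X) : {ae mu, forall p, (a *: x : X) p = a *: x p}.
Proof.
have -> : a *: x = \pi_X (a *: (repr x : L)) by rewrite l2_piZ reprK.
exact: repr_piE.
Qed.

Lemma measurable_inner (x y : X) :
  measurable_fun [set: P] (fun p => inner (x p) (y p)).
Proof.
under eq_fun do rewrite inner_polar.
apply: measurable_funM; first exact: measurable_cst.
apply: measurable_funB; first apply: measurable_funB.
- by apply: (measurable_sqr_norm hphi); exact: (l2val_measurable (repr x + repr y : L)).
- by apply: (measurable_sqr_norm hphi); exact: (l2val_measurable (repr x)).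
- by apply: (measurable_sqr_norm hphi); exact: (l2val_measurable (repr y)).
Qed.

Lemma integrable_inner (x y : X) :
  mu.-integrable [set: P] (fun p => (inner (x p) (y p))%:E).
Proof.
have := integrableD measurableT (l2_integrable (repr x)) (l2_integrable (repr y)).
apply: le_integrable => //; first exact/measurable_EFinP/measurable_inner.
move=> p _ /=; rewrite lee_fin (le_trans (normr_inner_le _ _))//.
by rewrite ler_norm.
Qed.

Definition di_inner (x y : X) : R := \int[mu]_p inner (x p) (y p).

Let ae_Rint (f g : P -> R) : measurable_fun [set: P] f ->
  measurable_fun [set: P] g -> {ae mu, forall p, f p = g p} ->
  \int[mu]_p f p = \int[mu]_p g p.
Proof.
move=> mf mg fg; congr fine; apply: ae_eq_integral => //.
- exact/measurable_EFinP.
- exact/measurable_EFinP.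
- by apply: filterS fg => p -> _.
Qed.

Let di_innerC x y : di_inner x y = di_inner y x.
Proof. by apply: eq_Rintegral => p _; exact: innerC. Qed.

Let di_innerDl x y z : di_inner (x + y) z = di_inner x z + di_inner y z.
Proof.
rewrite /di_inner -RintegralD//; try exact: integrable_inner.
apply: ae_Rint; first exact: measurable_inner.
  by apply: measurable_funD; exact: measurable_inner.
by apply: filterS (divalD x y) => p ->; rewrite innerDl.
Qed.

Let di_innerZl a x y : di_inner (a *: x) y = a * di_inner x y.
Proof.
rewrite /di_inner -RintegralZl//; try exact: integrable_inner.
apply: ae_Rint; first exact: measurable_inner.
  by apply: measurable_funM; [exact: measurable_cst|exact: measurable_inner].
by apply: filterS (divalZ a x) => p ->; rewrite innerZl.
Qed.

Let di_inner_ge0 x : 0 <= di_inner x x.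
Proof.
by apply: Rintegral_ge0 => p _; rewrite inner_normE sqr_ge0.
Qed.

Let di_inner_eq0 x : di_inner x x = 0 -> x = 0.
Proof.
move=> x0.
have mx := measurable_inner x x; have ix := integrable_inner x x.
have : (\int[mu]_p `|(inner (x p) (x p))%:E| = 0)%E.
  transitivity (\int[mu]_p (inner (x p) (x p))%:E)%E; last first.
    by rewrite -(fineK (integrable_fin_num measurableT ix)) [fine _]x0.
  apply: eq_integral => p _; rewrite gee0_abs// lee_fin inner_normE.
  exact: sqr_ge0.
move/ae_eq_integral_abs => /(_ measurableT); case; first exact/measurable_EFinP.
move=> N [mN N0 sN]; rewrite -[x]reprK; apply/l2_piP; exists N; split => // p.
move=> /= h; apply: sN => /= /(_ I) [] xp0; apply: h.
apply/eqP; rewrite -normr_eq0; move/eqP: xp0; rewrite inner_normE.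
by rewrite expf_eq0.
Qed.

HB.instance Definition _ := Lmodule_isPreHilbert.Build R X
  di_innerC di_innerDl di_innerZl di_inner_ge0 di_inner_eq0.

Lemma directIntegral_innerE (x y : X) :
  inner x y = \int[mu]_p inner (x p) (y p).
Proof. by []. Qed.

End direct_integral.

Section dual.
Context {R : realType}.

Record dual (V : normedModType R) := Dual {
  dual_linear :> {linear V -> R^o};
  dual_continuous : continuous dual_linear
}.

Variable V : normedModType R.
Local Notation V' := (dual V).

HB.instance Definition _ := gen_eqMixin V'.
HB.instance Definition _ := gen_choiceMixin V'.

Lemma dual_eq (f g : V') : f =1 g -> f = g.
Proof.
case: f g => [f cf] [g cg] /= fg.
have {}fg : f = g.
  case: f g {cf cg} fg => [f [[[f0 fD]] [fZ]]] [g [[[g0 gD]] [gZ]]] /= fg.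
  have {}fg : f = g by exact/funext.
  subst g; congr (GRing.Linear.Pack (GRing.Linear.Class _ _)).
    by congr (Algebra.isNmodMorphism.Axioms_ _ _ (_, _)); exact: Prop_irrelevance.
  by congr (GRing.isScalable.Axioms_ _ _ _ _ _); exact: Prop_irrelevance.
by subst g; congr Dual; exact: Prop_irrelevance.
Qed.

Definition dual_norm (f : V') : R := sup [set `|f x| | x in [set x | `|x| <= 1]].

Let dual_bounded (f : V') : exists2 M, 0 <= M & forall x, `|f x| <= M * `|x|.
Proof.
have /linear_bounded_continuous/linear_boundedP := @dual_continuous _ f.
by move=> /pinfty_ex_gt0[M M0 fM]; exists M => //; exact: ltW.
Qed.

Lemma le_dual_norm (f : V') x : `|f x| <= dual_norm f * `|x|.
Proof.
have [->|x0] := eqVneq x 0; first by rewrite linear0 !normr0 mulr0.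
have nx : 0 < `|x| by rewrite normr_gt0.
rewrite -ler_pdivrMr//.
have -> : `|f x| / `|x| = `|f (`|x|^-1 *: x)|.
  by rewrite linearZ/= normrZ normfV normr_id mulrC.
apply: ub_le_sup; last first.
  by exists (`|x|^-1 *: x) => //=; rewrite normrZ normfV normr_id mulVf ?gt_eqF.
have [M M0 fM] := dual_bounded f; exists M => _ [y /= y1 <-].
by rewrite (le_trans (fM y))// ler_piMr.
Qed.

Lemma dual_norm_le (f : V') M : 0 <= M -> (forall x, `|f x| <= M * `|x|) ->
  dual_norm f <= M.
Proof.
move=> M0 fM; apply: ge_sup.
  by exists `|f 0|; exists 0 => //=; rewrite normr0 ler01.
by move=> _ [y /= y1 <-]; rewrite (le_trans (fM y))// ler_piMr.
Qed.

Let dual_norm_ge0 (f : V') : 0 <= dual_norm f.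
Proof.
have [M M0 fM] := dual_bounded f.
apply: (@le_trans _ _ `|f 0|); first exact: normr_ge0.
apply: ub_le_sup; last by exists 0 => //=; rewrite normr0 ler01.
by exists M => _ [y /= y1 <-]; rewrite (le_trans (fM y))// ler_piMr.
Qed.

Let zero_cts : continuous (\0 : {linear V -> R^o}).
Proof. by move=> x; exact: cvg_cst. Qed.

Let add_cts (f g : V') : continuous (f \+ g : {linear V -> R^o}).
Proof. by move=> x; apply: cvgD; exact: dual_continuous. Qed.

Let scale_cts a (f : V') : continuous (a \*: f : {linear V -> R^o}).
Proof. by move=> x; apply: cvgZr; exact: dual_continuous. Qed.

Let dual0 : V' := Dual zero_cts.
Let dual_add (f g : V') : V' := Dual (@add_cts f g).
Let dual_scale a (f : V') : V' := Dual (@scale_cts a f).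

Let dual_addA : associative dual_add.
Proof. by move=> f g h; apply: dual_eq => x /=; rewrite addrA. Qed.
Let dual_addC : commutative dual_add.
Proof. by move=> f g; apply: dual_eq => x /=; rewrite addrC. Qed.
Let dual_add0 : left_id dual0 dual_add.
Proof. by move=> f; apply: dual_eq => x /=; rewrite add0r. Qed.
Let dual_addN : left_inverse dual0 (dual_scale (-1)) dual_add.
Proof. by move=> f; apply: dual_eq => x /=; rewrite scaleN1r addNr. Qed.

HB.instance Definition _ :=
  GRing.isZmodule.Build V' dual_addA dual_addC dual_add0 dual_addN.

Let dual_scaleA a b f : dual_scale a (dual_scale b f) = dual_scale (a * b) f.
Proof. by apply: dual_eq => x /=; rewrite scalerA. Qed.
Let dual_scale1 : left_id 1 dual_scale.
Proof. by move=> f; apply: dual_eq => x /=; rewrite scale1r. Qed.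
Let dual_scaleDr : right_distributive dual_scale +%R.
Proof. by move=> a f g; apply: dual_eq => x /=; rewrite scalerDr. Qed.
Let dual_scaleDl f : {morph dual_scale^~ f : a b / a + b}.
Proof. by move=> a b; apply: dual_eq => x /=; rewrite scalerDl. Qed.

HB.instance Definition _ := GRing.Zmodule_isLmodule.Build R V'
  dual_scaleA dual_scale1 dual_scaleDr dual_scaleDl.

Let dual_normD (f g : V') : dual_norm (f + g) <= dual_norm f + dual_norm g.
Proof.
apply: dual_norm_le => [|x]; first by rewrite addr_ge0.
by rewrite mulrDl (le_trans (ler_normD _ _))// lerD// le_dual_norm.
Qed.

Let dual_normZ_le a (f : V') : dual_norm (a *: f) <= `|a| * dual_norm f.
Proof.
apply: dual_norm_le => [|x]; first by rewrite mulr_ge0.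
by rewrite -mulrA [`|_|]normrZ ler_wpM2l// le_dual_norm.
Qed.

Let dual_normZ a (f : V') : dual_norm (a *: f) = `|a| * dual_norm f.
Proof.
apply/eqP; rewrite eq_le dual_normZ_le/=.
have [->|a0] := eqVneq a 0; first by rewrite normr0 mul0r.
rewrite mulrC -ler_pdivlMr ?normr_gt0// mulrC -normfV.
by rewrite -{1}[f](scalerK a0).
Qed.

Let dual_norm0_eq0 (f : V') : dual_norm f = 0 -> f = 0.
Proof.
move=> f0; apply: dual_eq => x; apply/eqP; rewrite -normr_le0.
by have := le_dual_norm f x; rewrite f0 mul0r.
Qed.

HB.instance Definition _ :=
  Lmodule_isNormed.Build R V' dual_normD dual_normZ dual_norm0_eq0.

Lemma dual_normE (f : V') : `|f| = dual_norm f.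
Proof. by []. Qed.

End dual.

Section forms.
Context {R : realType} {U V : normedModType R}.
Implicit Types b : U -> V -> R.

Definition bounded_form b := exists M, forall w v, `|b w v| <= M * (`|w| * `|v|).

Definition quotients_at b (w : U) : set (\bar R) :=
  [set (b w v / (`|w| * `|v|))%:E | v in [set v | v != 0]].

(* Extended-real sup and inf: over a zero space, sup is -oo and inf is +oo. *)
Definition sup_sup b : \bar R :=
  ereal_sup [set ereal_sup (quotients_at b w) | w in [set w | w != 0]].

Definition inf_sup b : \bar R :=
  ereal_inf [set ereal_sup (quotients_at b w) | w in [set w | w != 0]].

Definition right_nondegenerate b :=
  forall v, v != 0 -> exists w, b w v != 0.

Definition bounded_operator (T : U -> V) := exists M, forall x, `|T x| <= M * `|x|.

End forms.

Section integrated_form.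
Context {d : measure_display} {P : measurableType d} {R : realType}.
Context {mu : probability P R} {U V : P -> hilbertType R}.
Context {phi : nat -> forall p, U p} {psi : nat -> forall p, V p}.
Context {hphi : fundamental_sequence phi} {hpsi : fundamental_sequence psi}.
Local Notation X := (directIntegral mu hphi).
Local Notation Y := (directIntegral mu hpsi).
Variable b : forall p, U p -> V p -> R.

Definition integrated_form (w : X) (v : Y) : R := \int[mu]_p b (w p) (v p).

(* `\int` is a total function, so existence of the integral is required
   separately. *)
Definition is_isomorphism_to_dual :=
  (forall (w : X) (v : Y),
     mu.-integrable [set: P] (fun p => (b (w p) (v p))%:E)) /\
  exists B : {linear X -> dual Y},
    [/\ forall w v, B w v = integrated_form w v,
        bounded_operator B &
        exists S : dual Y -> X,
          [/\ cancel B S, cancel S B & bounded_operator S]].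

End integrated_form.

Arguments integrated_form {d P R mu U V phi psi hphi hpsi} b w v.
Arguments is_isomorphism_to_dual {d P R} mu {U V phi psi} hphi hpsi b.

(* Main.v *)
Require Import Defs.
From HB Require Import structures.
From mathcomp Require Import all_boot all_order all_algebra.
From mathcomp Require Import all_classical all_reals all_analysis.
From mathcomp Require Import measurable_realfun generic_quotient ring lra.

Set Implicit Arguments.
Unset Strict Implicit.
Unset Printing Implicit Defensive.

Import Order.TTheory GRing.Theory Num.Theory.
Import numFieldNormedType.Exports.

Local Open Scope classical_set_scope.
Local Open Scope ring_scope.

(* Write b(w, v; p) = <T_p w, v> by Riesz. The three pointwise conditions say
   |T_p w| <= C |w|, c |w| <= |T_p w| and ker T_p^* = 0, and the same dictionary
   applies to the integrated form and the operator w |-> (p |-> T_p w(p)).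
   Pointwise bounds integrate. Conversely, testing an integrated bound on a
   section cut off to the set where the pointwise bound fails gives it almost
   everywhere for each of the countably many rational combinations of the
   fundamental sequence, hence, by density, for all vectors of almost every
   fibre; ker T_p^* = 0 comes out as a lower bound for the adjoint.
   Surjectivity of the global operator needs no fibrewise inverse: as the direct
   integrals are complete, it follows by minimizing a quadratic functional. *)

(** * Inner products and geometrically fast convergence *)

Lemma inner_le_norm (R : realType) (H : preHilbertType R) (u v : H) :
  inner u v <= `|u| * `|v|.
Proof.
have : `|u + v| ^+ 2 <= (`|u| + `|v|) ^+ 2.
  by rewrite ler_pXn2r ?nnegrE ?addr_ge0// ler_normD.
by rewrite sqr_normD; lra.
Qed.

Lemma cauchy_schwarz (R : realType) (H : preHilbertType R) (u v : H) :
  `|inner u v| <= `|u| * `|v|.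
Proof.
rewrite ler_norml inner_le_norm andbT lerNl -innerNl.
by rewrite (le_trans (inner_le_norm _ _))// normrN.
Qed.

Lemma inner_inj (R : realType) (H : preHilbertType R) (u v : H) :
  (forall x, inner u x = inner v x) -> u = v.
Proof.
move=> uv; apply/eqP; rewrite -subr_eq0 -normr_eq0 -sqrf_eq0 -inner_normE.
by rewrite {1}innerDl innerNl uv subrr.
Qed.

Lemma half_exprn_small (R : realType) (C e : R) : 0 < e ->
  exists N, forall n, (N <= n)%N -> C * 2^-1 ^+ n < e.
Proof.
move=> e0.
have h : (fun n => (2 : R)^-1 ^+ n) @ \oo --> (0 : R).
  by apply: cvg_expr; rewrite gtr0_norm ?invr_gt0// invf_lt1// ltr1n.
have /cvgrPdist_lt/(_ _ e0)[N _ hN] :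
    (fun n => C * (2 : R)^-1 ^+ n) @ \oo --> C * (0 : R) by exact: cvgMr.
exists N => n /hN; rewrite mulr0 /= sub0r normrN; apply: le_lt_trans.
exact: ler_norm.
Qed.

Lemma cvg_of_sqr_dist0 (R : realType) (V : normedModType R) (u : nat -> V)
    (l : V) (C : R) :
  (forall n, `|l - u n| ^+ 2 <= C * 2^-1 ^+ n) -> u @ \oo --> l.
Proof.
move=> hu; apply/cvgrPdist_lt => e e0.
have [N hN] := half_exprn_small C (exprn_gt0 2 e0).
exists N => // n /hN /= h.
by rewrite -(@ltr_pXn2r _ 2) ?nnegrE ?(ltW e0)// (le_lt_trans (hu n)).
Qed.

Lemma inner_cvg (R : realType) (H : preHilbertType R) (u : nat -> H) (l x : H) :
  u @ \oo --> l -> (fun n => inner (u n) x) @ \oo --> inner l x.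
Proof.
move=> ul; rewrite inner_polar; under eq_fun do rewrite inner_polar.
apply: cvgMr; apply: cvgB; last exact: cvg_cst.
apply: cvgB; last by apply: cvgM; exact: cvg_norm.
by apply: cvgM; apply: cvg_norm; apply: cvgD => //; exact: cvg_cst.
Qed.

(** Evaluation at the vertex [t = - b / a] gives the inequality; for [a = 0] an affine function that
    stays nonnegative has slope zero. *)
Lemma quadratic_ge0_discr (R : realType) (a b e : R) : 0 <= a ->
  (forall t, 0 <= a * t ^+ 2 + 2 * b * t + e) -> b ^+ 2 <= e * a.
Proof.
move=> a0 h; have [{a0}az|ann] := eqVneq a 0.
  have [->|b0] := eqVneq b 0; first by rewrite az mulr0 expr0n.
  (* At this [t] the affine function takes the value -1. *)
  have := h (- (e + 1) / (2 * b)).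
  rewrite az mul0r add0r mulrC divfK ?mulf_neq0 ?pnatr_eq0//.
  by move=> ?; exfalso; lra.
have := h (- b / a).
rewrite (_ : _ + e = (e * a - b ^+ 2) / a); last by field.
by rewrite pmulr_lge0 ?invr_gt0 ?lt_def ?ann// subr_ge0.
Qed.

(** Squared distances are used because coercivity of a quadratic form controls squared norms. *)
Lemma cvg_of_sqr_dist_le (R : realType) (H : completeNormedModType R)
    (u : nat -> H) (C : R) :
  (forall m n, `|u m - u n| ^+ 2 <= C * (2^-1 ^+ m + 2^-1 ^+ n)) -> cvg (u @ \oo).
Proof.
move=> hu; apply: cauchy_cvg; apply: cauchy_exP => e e0.
have [N hN] := half_exprn_small (C * 2) (exprn_gt0 2 e0).
exists (u N); exists N => // n /= Nn.
rewrite -ball_normE/= -(@ltr_pXn2r _ 2) ?nnegrE ?(ltW e0)//.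
apply: le_lt_trans (hu _ _) _.
have C0 : 0 <= C.
  have := le_trans (sqr_ge0 _) (hu 0%N 0%N).
  by rewrite !expr0 -(@pmulr_lge0 _ (1 + 1) C).
have nN : (2 : R)^-1 ^+ n <= 2^-1 ^+ N by apply: ler_wiXn2l => //; lra.
by apply: le_lt_trans (hN N (leqnn N)); rewrite -mulrA ler_wpM2l//; lra.
Qed.

(** * Minimization of quadratic functionals, with Riesz representation and surjectivity as
    consequences *)

Section symmetric_lax_milgram.
Variables (R : realType) (H : hilbertType R) (a : H -> H -> R) (f : H -> R).
Variables (c M K : R).
Hypotheses (aC : forall u v, a u v = a v u)
  (aD : forall u v w, a (u + v) w = a u w + a v w)
  (aZ : forall k u v, a (k *: u) v = k * a u v)
  (a_coercive : forall u, c * `|u| ^+ 2 <= a u u)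
  (a_bounded : forall u v, `|a u v| <= M * (`|u| * `|v|))
  (fD : forall u v, f (u + v) = f u + f v)
  (fZ : forall k u, f (k *: u) = k * f u)
  (f_bounded : forall u, `|f u| <= K * `|u|)
  (c0 : 0 < c).

(** Twice the Ritz energy, whose minimizer [l] solves [a l x = f x] for all [x]. *)
Let J u := a u u - 2 * f u.

Let aDr u v w : a u (v + w) = a u v + a u w.
Proof. by rewrite aC aD !(aC u). Qed.

Let aZr k u v : a u (k *: v) = k * a u v.
Proof. by rewrite aC aZ (aC u). Qed.

Let aN u v : a (- u) v = - a u v.
Proof. by rewrite -scaleN1r aZ mulN1r. Qed.

Let aNr u v : a u (- v) = - a u v.
Proof. by rewrite aC aN (aC u). Qed.

(** Completing the square in [|u|]: [c |u|^2 - 2 K |u| >= - K^2 / c]. *)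
Let J_lb : has_lbound (range J).
Proof.
exists (- (K ^+ 2 / c)) => _ [u _ <-].
have := a_coercive u; have := ler_norm (f u); have := f_bounded u.
have : 0 <= c * (`|u| - K / c) ^+ 2 by rewrite mulr_ge0 ?sqr_ge0// ltW.
rewrite (_ : c * _ = c * `|u| ^+ 2 - 2 * (K * `|u|) + K ^+ 2 / c).
  by rewrite /J => *; lra.
by field; rewrite gt_eqF.
Qed.

Let m := inf (range J).

Let m_le u : m <= J u.
Proof. by apply: ge_inf => //; exists u. Qed.

Let minseq n : {u | J u < m + 2^-1 ^+ n}.
Proof.
apply: cid; have [||_ [u _ <-] Ju] := @inf_adherent _ (range J) (2^-1 ^+ n).
- by rewrite exprn_gt0// invr_gt0.
- by split; [exists (J 0), 0|exact: J_lb].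
by exists u.
Qed.

Let u n := sval (minseq n).

Let Ju n : J (u n) < m + 2^-1 ^+ n. Proof. by rewrite /u; case: minseq. Qed.

(* Parallelogram law: the midpoint has J >= m, which makes minimizing
   sequences Cauchy. *)
Let u_cvg : cvg (u @ \oo).
Proof.
apply: (@cvg_of_sqr_dist_le _ _ _ (2 / c)) => k n.
have := a_coercive (u k - u n); have := Ju k; have := Ju n.
have := m_le (2^-1 *: (u k + u n)); rewrite /J.
rewrite !(aD, aDr, aZ, aZr, aN, aNr, fD, fZ) (aC (u n) (u k)) => h1 h2 h3 h4.
rewrite mulrAC ler_pdivlMr// mulrC.
by move: h1 h2 h3 h4; lra.
Qed.

(** The energy is not evaluated at the limit. Since [u n] is within [2^-n] of the infimum,
    [J (u n + t x) >= m] for all [t] bounds a discriminant: [(a (u n) x - f x)^2 <= 2^-n a x x].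
    Hence [a (u n) x] tends both to [f x] and to [a l x]. *)
Lemma symmetric_lax_milgram : exists l, forall x, a l x = f x.
Proof.
exists (lim (u @ \oo)) => x.
have a_le : forall y z : H, `|a y z| <= `|M| * (`|y| * `|z|).
  by move=> y z; rewrite (le_trans (a_bounded _ _))// ler_wpM2r ?mulr_ge0 ?ler_norm.
have axx : 0 <= a x x.
  by rewrite (le_trans _ (a_coercive x))// mulr_ge0 ?sqr_ge0// ltW.
have disc n : (a (u n) x - f x) ^+ 2 <= 2^-1 ^+ n * a x x.
  apply: quadratic_ge0_discr => // t.
  have := m_le (u n + t *: x); have := Ju n; rewrite /J.
  rewrite !(aD, aDr, aZ, aZr, fD, fZ) (aC x (u n)) => h1 h2.
  by move: h1 h2; lra.
have au : (fun n => a (u n) x) @ \oo --> a (lim (u @ \oo)) x.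
  apply/cvgrPdist_le => e e0.
  have ep : 0 < e / (`|M| * `|x| + 1) by rewrite divr_gt0// ltr_wpDl// mulr_ge0.
  have [N _ hN] := (cvgrPdist_le _ _).1 u_cvg _ ep.
  exists N => // n /hN /=; rewrite ler_pdivlMr ?ltr_wpDl ?mulr_ge0// => h.
  have -> : a (lim (u @ \oo)) x - a (u n) x = a (lim (u @ \oo) - u n) x.
    by rewrite aD aN.
  by rewrite (le_trans (a_le _ _))// (le_trans _ h)// mulrDr mulr1 mulrCA ler_wpDr.
have af : (fun n => a (u n) x) @ \oo --> f x.
  apply: (@cvg_of_sqr_dist0 _ _ _ _ (a x x)) => n.
  by rewrite distrC real_normK ?num_real// mulrC; exact: disc.
exact: (cvg_unique _ au af).
Qed.

End symmetric_lax_milgram.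

Lemma riesz_representation (R : realType) (H : hilbertType R) (f : H -> R) (K : R) :
  (forall u v, f (u + v) = f u + f v) -> (forall k u, f (k *: u) = k * f u) ->
  (forall u, `|f u| <= K * `|u|) -> exists l, forall x, inner l x = f x.
Proof.
move=> fD fZ fK.
apply: (@symmetric_lax_milgram _ H _ f 1 1 K) => //.
- exact: innerC.
- exact: innerDl.
- exact: innerZl.
- by move=> u; rewrite mul1r inner_normE.
- by move=> u v; rewrite mul1r cauchy_schwarz.
Qed.

(* The solution of T w = y is found by minimizing |T w|^2 - 2 <y, T w>, which is
   possible as T is bounded below: the residual T w - y is then orthogonal to
   the range of T, hence killed by the adjoint. *)
Lemma surjective_of_bounded_below (R : realType) (H : hilbertType R)
    (G : preHilbertType R) (T : {linear H -> G}) (T' : G -> H) (c C : R) :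
  0 < c -> (forall w, c * `|w| <= `|T w|) -> (forall w, `|T w| <= C * `|w|) ->
  (forall w v, inner (T w) v = inner w (T' v)) ->
  (forall v, T' v = 0 -> v = 0) ->
  forall y, exists w, T w = y.
Proof.
move=> c0 cT TC adj T'0 y.
have [|||||||||w hw] := @symmetric_lax_milgram _ H (fun u v => inner (T u) (T v))
  (fun u => inner y (T u)) (c ^+ 2) (`|C| ^+ 2) (`|y| * `|C|).
- by move=> u v; exact: innerC.
- by move=> u v w; rewrite linearD innerDl.
- by move=> k u v; rewrite linearZ innerZl.
- move=> u; rewrite inner_normE -exprMn ler_pXn2r ?nnegrE//.
  by rewrite mulr_ge0// ltW.
- move=> u v; rewrite (le_trans (cauchy_schwarz _ _))// expr2 mulrACA.
  by rewrite ler_pM// (le_trans (TC _))// ler_wpM2r// ler_norm.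
- by move=> u v; rewrite linearD innerDr.
- by move=> k u; rewrite linearZ innerZr.
- move=> u; rewrite (le_trans (cauchy_schwarz _ _))// -mulrA ler_wpM2l//.
  by rewrite (le_trans (TC _))// ler_wpM2r// ler_norm.
- by rewrite exprn_gt0.
exists w; apply/eqP; rewrite -subr_eq0; apply/eqP/T'0/inner_inj => x.
by rewrite inner0l innerC -adj innerC innerDl innerNl hw subrr.
Qed.

(** * Convergence of sequences with geometrically small steps *)

(** A Cauchy filter contains a ball of each radius [e n]. Consecutive balls meet, so their centres
    form a sequence of the given kind, and its limit is the limit of the filter. *)
Lemma complete_of_geometric (R : realType) (V : normedModType R) :
  (forall u : nat -> V, (forall n, `|u n.+1 - u n| <= 4^-1 ^+ n) ->
     cvg (u @ \oo)) ->
  forall F : set_system V, ProperFilter F -> cauchy F -> cvg F.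
Proof.
move=> hV F FF /cauchyP cF.
(* The factor 1/2 makes the sum of two consecutive radii at most [4^-n]. *)
pose e n : R := 2^-1 * 4^-1 ^+ n.
have e0 n : 0 < e n by rewrite mulr_gt0// exprn_gt0.
have /choice[u hu] n : exists x, F (ball x (e n)) by exact: cF.
have /hV/cvg_ex[l ul] : forall n, `|u n.+1 - u n| <= 4^-1 ^+ n.
  move=> n; have [x []] := filter_ex (filterI (hu n) (hu n.+1)).
  rewrite -!ball_normE/= => h1 h2; rewrite -(subrKA x).
  rewrite (le_trans (ler_normD _ _))// [leRHS](_ : _ = e n + e n).
    rewrite lerD//; last by rewrite distrC ltW.
    apply: le_trans (ltW h2) _; rewrite ler_pM2l// exprS ler_piMl ?exprn_ge0//.
    by rewrite invf_le1// ler1n.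
  by rewrite /e; field.
apply/cvg_ex; exists l; apply/cvgrPdist_le => eps eps0.
have eps20 : 0 < eps / 2 by rewrite divr_gt0.
have [N _ hN] := (cvgrPdist_le _ _).1 ul _ eps20.
have /cvgrPdist_le/(_ _ eps20)[N' _ hN'] :
    (fun n => (4 : R)^-1 ^+ n) @ \oo --> (0 : R).
  by apply: cvg_expr; rewrite gtr0_norm ?invr_gt0// invf_lt1// ltr1n.
pose n := maxn N N'.
apply: filterS (hu n) => x; rewrite -ball_normE/= => hx.
rewrite -(subrKA (u n)) (le_trans (ler_normD _ _))// [leRHS]splitr lerD//.
  by apply: hN; rewrite /= leq_maxl.
have := hN' n (leq_maxr _ _); rewrite /= sub0r normrN ger0_norm ?exprn_ge0//.
apply: le_trans; rewrite (le_trans (ltW hx))// /e ler_piMl ?exprn_ge0//.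
by rewrite invf_le1// ler1n.
Qed.

Lemma geometric_cvg (R : realType) (V : completeNormedModType R) (u : nat -> V)
    (k : R) : (forall n, `|u n.+1 - u n| <= k * 2^-1 ^+ n) ->
  cvg (u @ \oo) /\ forall n, `|lim (u @ \oo) - u n| <= 2 * k * 2^-1 ^+ n.
Proof.
move=> hu.
have k0 : 0 <= k.
  by have := le_trans (normr_ge0 _) (hu 0%N); rewrite expr0 mulr1.
have h0 n : 0 <= k * 2^-1 ^+ n by rewrite mulr_ge0 ?exprn_ge0.
(* The subtracted tail of the geometric series lets the induction on [j] close. *)
have hmn n j : `|u (n + j)%N - u n| <= 2 * k * 2^-1 ^+ n - 2 * k * 2^-1 ^+ (n + j).
  elim: j => [|j ih].
    by rewrite addn0 !subrr normr0.
  rewrite addnS -(subrKA (u (n + j)%N)) (le_trans (ler_normD _ _))//.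
  by have := hu (n + j)%N; move: ih; rewrite [_ ^+ _.+1]exprS; lra.
have hmn' n m : (n <= m)%N -> `|u m - u n| <= 2 * k * 2^-1 ^+ n.
  move=> nm; have := hmn n (m - n)%N; rewrite subnKC//.
  by have := h0 m; lra.
have ucvg : cvg (u @ \oo).
  apply: (@cvg_of_sqr_dist_le _ _ _ (4 * k ^+ 2)).
  have : forall n m, (n <= m)%N ->
      `|u m - u n| ^+ 2 <= 4 * k ^+ 2 * (2^-1 ^+ m + 2^-1 ^+ n).
    move=> n m /hmn' nm.
    have : `|u m - u n| ^+ 2 <= (2 * k * 2^-1 ^+ n) ^+ 2.
      by rewrite ler_pXn2r ?nnegrE// -mulrA mulr_ge0.
    move=> /le_trans; apply; rewrite exprMn.
    rewrite [(2 * k) ^+ 2](_ : _ = 4 * k ^+ 2); last by ring.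
    rewrite ler_wpM2l// ?mulr_ge0 ?sqr_ge0// expr2 ler_wpDl ?exprn_ge0//.
    by rewrite ler_piMr ?exprn_ge0// exprn_ile1// invf_le1// ler1n.
  move=> H m n; have [|/ltnW] := leqP n m; first exact: H.
  by rewrite distrC [_ ^+ m + _]addrC; exact: H.
split=> // n; have c : `|u m - u n| @[m --> \oo] --> `|lim (u @ \oo) - u n|.
  by apply: cvg_norm; apply: cvgB => //; exact: cvg_cst.
rewrite -(cvg_lim _ c)//; apply: limr_le; first by apply/cvg_ex; eexists; exact: c.
by exists n => // m /= ; exact: hmn'.
Qed.

(** * Measurable sections and norms in the direct integral *)

Section measurable_sections.
Context {d : measure_display} {P : measurableType d} {R : realType}.
Context {W : P -> hilbertType R} {phi : nat -> forall p, W p}.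
Hypothesis hphi : fundamental_sequence phi.

Lemma measurable_sectionD (v w : forall p, W p) :
  measurable_section phi v -> measurable_section phi w ->
  measurable_section phi (fun p => v p + w p).
Proof.
move=> mv mw n; under eq_fun do rewrite innerDl.
by apply: measurable_funD.
Qed.

Lemma measurable_sectionZ (f : P -> R) (v : forall p, W p) :
  measurable_fun [set: P] f -> measurable_section phi v ->
  measurable_section phi (fun p => f p *: v p).
Proof.
move=> mf mv n; under eq_fun do rewrite innerZl.
by apply: measurable_funM.
Qed.

(** Measurability of a section is only tested against [phi n]; polarization reduces a pair of
    sections to squared norms, which are measurable by density. *)
Lemma measurable_inner_section (v w : forall p, W p) :
  measurable_section phi v -> measurable_section phi w ->
  measurable_fun [set: P] (fun p => inner (v p) (w p)).
Proof.
move=> mv mw; under eq_fun do rewrite inner_polar.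
apply: measurable_funM; first exact: measurable_cst.
by do ![apply: measurable_funB]; apply: (measurable_sqr_norm hphi) => //;
  exact: measurable_sectionD.
Qed.

End measurable_sections.

Section direct_integral_norm.
Local Open Scope quotient_scope.
Context {d : measure_display} {P : measurableType d} {R : realType}.
Variable mu : probability P R.
Context {W : P -> hilbertType R} {phi : nat -> forall p, W p}.
Variable hphi : fundamental_sequence phi.
Local Notation X := (directIntegral mu hphi).

Lemma divalP (x : X) : measurable_section phi (fun p => x p).
Proof. exact: (l2val_measurable (repr x)). Qed.

Lemma dival0 : {ae mu, forall p, (0 : X) p = 0}.
Proof. by have := divalZ 0 (0 : X); apply: filterS => p; rewrite !scale0r. Qed.

Lemma divalB (x y : X) : {ae mu, forall p, (x - y : X) p = x p - y p}.
Proof.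
rewrite -scaleN1r; apply: filterS2 (divalD x (-1 *: y)) (divalZ (-1) y).
by move=> p -> ->; rewrite scaleN1r.
Qed.

Lemma di_integrable_sqr_norm (x : X) :
  mu.-integrable [set: P] (EFin \o (fun p => `|x p| ^+ 2)).
Proof. exact: (l2_integrable (repr x)). Qed.

Lemma di_sqr_normE (x : X) : `|x| ^+ 2 = \int[mu]_p (`|x p| ^+ 2).
Proof.
rewrite -inner_normE directIntegral_innerE.
by apply: eq_Rintegral => p _; rewrite inner_normE.
Qed.

(** The difference [g - f] agrees almost everywhere with its absolute value, whose integral is
    nonnegative. *)
Lemma ae_le_Rintegral (f g : P -> R) :
  mu.-integrable [set: P] (EFin \o f) -> mu.-integrable [set: P] (EFin \o g) ->
  {ae mu, forall p, f p <= g p} -> \int[mu]_p f p <= \int[mu]_p g p.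
Proof.
move=> fi gi fg.
have mgf : measurable_fun [set: P] (fun p => g p - f p).
  apply: measurable_funB; apply/measurable_EFinP.
    exact: measurable_int gi.
  exact: measurable_int fi.
rewrite -subr_ge0 -RintegralB//.
suff -> : \int[mu]_p (g p - f p) = \int[mu]_p `|g p - f p|.
  exact: Rintegral_ge0.
congr fine; apply: ae_eq_integral => //.
- exact/measurable_EFinP.
- by apply/measurable_EFinP; exact: measurableT_comp.
- by apply: filterS fg => p fg _; rewrite ger0_norm// subr_ge0.
Qed.

Lemma di_sqr_norm_le (x : X) (g : P -> R) :
  mu.-integrable [set: P] (EFin \o g) -> {ae mu, forall p, `|x p| ^+ 2 <= g p} ->
  `|x| ^+ 2 <= \int[mu]_p g p.
Proof.
move=> gi xg; rewrite di_sqr_normE.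
by apply: ae_le_Rintegral => //; exact: di_integrable_sqr_norm.
Qed.

(** Every element defined fibrewise below is obtained here; its chosen representative is known only
    up to a null set. *)
Lemma di_of_section (v : forall p, W p) (g : P -> R) :
  measurable_section phi v -> mu.-integrable [set: P] (EFin \o g) ->
  {ae mu, forall p, `|v p| ^+ 2 <= g p} ->
  exists x : X, {ae mu, forall p, x p = v p}.
Proof.
move=> mv gi vg.
have fv : (\int[mu]_p (`|v p| ^+ 2)%:E < +oo)%E.
  have /integrableP[mg] := gi; apply: le_lt_trans.
  apply: ae_ge0_le_integral => //.
  - by apply/measurable_EFinP; exact: (measurable_sqr_norm hphi).
  - exact: measurableT_comp.
  - by apply: filterS vg => p vg _ /=; rewrite lee_fin (le_trans vg)// ler_norm.
by exists (\pi_X (L2Section hphi mv fv)); exact: repr_piE.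
Qed.

End direct_integral_norm.

(** * Completeness of the direct integral, in the manner of Riesz and Fischer *)

Section direct_integral_complete.
Context {d : measure_display} {P : measurableType d} {R : realType}.
Variable mu : probability P R.
Context {W : P -> hilbertType R} {phi : nat -> forall p, W p}.
Variable hphi : fundamental_sequence phi.
Local Notation X := (directIntegral mu hphi).

Section geometric_sequence.
Variable u : nat -> X.
Hypothesis hu : forall n, `|u n.+1 - u n| <= 4^-1 ^+ n.

(* Since sum_n f n is integrable, the steps of u are almost everywhere bounded by
   a multiple of 2^-n. *)
Let f n p : R := 4 ^+ n * `|u n.+1 p - u n p| ^+ 2.

Let f_ge0 n p : 0 <= f n p. Proof. by rewrite mulr_ge0 ?exprn_ge0. Qed.

Let mf n : measurable_fun [set: P] (f n).
Proof.
apply: measurable_funM; first exact: measurable_cst.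
apply: (measurable_sqr_norm hphi).
apply: measurable_sectionD; first exact: divalP.
rewrite (_ : (fun p => - u n p) = (fun p => cst (-1) p *: u n p)).
  by apply: measurable_sectionZ; [exact: measurable_cst|exact: divalP].
by apply: functional_extensionality_dep => p; rewrite scaleN1r.
Qed.

(** The integral is at most [4^n (4^-n)^2 = 4^-n], weakened to [2^-n] in the form that
    [epsilon_trick0] sums. *)
Let int_f n : (\int[mu]_p (f n p)%:E <= (2 / (2 ^ n.+1)%:R)%:E)%E.
Proof.
have ix := di_integrable_sqr_norm (u n.+1 - u n : X).
have -> : (\int[mu]_p (f n p)%:E =
    \int[mu]_p ((4 ^+ n)%:E * (`|(u n.+1 - u n : X) p| ^+ 2)%:E))%E.
  apply: ae_eq_integral => //; first exact/measurable_EFinP.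
    apply: measurable_funeM; exact: measurable_int ix.
  by apply: filterS (divalB (u n.+1) (u n)) => p + _; rewrite /f => ->.
rewrite integralZl// -(fineK (integrable_fin_num measurableT ix)).
rewrite -[fine _]di_sqr_normE -EFinM lee_fin.
have h : `|u n.+1 - u n| ^+ 2 <= (4^-1 ^+ n) ^+ 2.
  by rewrite ler_pXn2r ?nnegrE ?exprn_ge0.
rewrite (le_trans (ler_wpM2l (exprn_ge0 _ _) h))// expr2 mulrA -exprMn mulfV//.
rewrite expr1n mul1r exprVn natrX exprS invfM mulrA mulfV// mul1r.
by rewrite lef_pV2 ?posrE ?exprn_gt0// lerXn2r ?nnegrE// ler_nat.
Qed.

Let K p : \bar R := (\sum_(n <oo) (f n p)%:E)%E.

Let mK : measurable_fun [set: P] K.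
Proof.
apply: (@ge0_emeasurable_sum _ _ _ _ (fun n p => (f n p)%:E) xpredT) => [n p _ _|n _].
  by rewrite lee_fin.
exact/measurable_EFinP.
Qed.

Let K_ge0 p : (0 <= K p)%E.
Proof. by apply: nneseries_ge0 => n _ _; rewrite lee_fin. Qed.

Let K_int : mu.-integrable [set: P] K.
Proof.
apply/integrableP; split => //.
under eq_integral do rewrite gee0_abs//.
rewrite integral_nneseries//; last 2 first.
- by move=> n; exact/measurable_EFinP.
- by move=> n p _; rewrite lee_fin.
apply: (@le_lt_trans _ _ (2 : R)%:E); last exact: ltry.
apply: le_trans (@epsilon_trick0 _ 2 xpredT _) => //.
by apply: lee_nneseries => [n _ _|n _ //]; apply: integral_ge0 => p _; rewrite lee_fin.
Qed.

(** [fine] sends the value [+oo] to 0, which alters [K] only on the null set outside [G]. *)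
Let k p : R := fine (K p).

Let k_int : mu.-integrable [set: P] (EFin \o k).
Proof.
apply: le_integrable K_int => //.
  by apply/measurable_EFinP; exact: measurableT_comp.
move=> p _; rewrite /k /=; have := K_ge0 p; case: (K p) => [r| |]//= _.
by rewrite normr0 leey.
Qed.

Let G := [set p | K p \is a fin_num].

Let mG : measurable G.
Proof. by rewrite -[G]setTI; exact: emeasurable_fin_num. Qed.

Let aeG : {ae mu, forall p, G p}.
Proof. by apply: filterS (integrable_ae measurableT K_int) => p; apply. Qed.

(** The sum [k p] bounds its single term [f n p], and the square root turns [4^n] into [2^n]. *)
Let step_le p n : G p -> `|u n.+1 p - u n p| <= Num.sqrt (k p) * 2^-1 ^+ n.
Proof.
move=> Gp; have : f n p <= k p.
  rewrite -lee_fin fineK// /K (@nneseriesD1 _ _ n)// => [|i _]; last by rewrite lee_fin.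
  by rewrite leeDl// nneseries_ge0// => i _ _; rewrite lee_fin.
rewrite /f => h; have k0 : 0 <= k p by rewrite fine_ge0.
rewrite -(@ler_pXn2r _ 2) ?nnegrE ?mulr_ge0 ?sqrtr_ge0 ?exprn_ge0//.
rewrite exprMn sqr_sqrtr// -exprM mulnC exprM exprVn.
rewrite (_ : 2 ^+ 2 = 4); last by ring.
by rewrite exprVn ler_pdivlMr ?exprn_gt0// mulrC.
Qed.

Let l p : W p := if p \in G then lim ((fun n => u n p) @ \oo) else 0.

Let cvg_l p : G p -> (fun n => u n p) @ \oo --> l p.
Proof.
move=> Gp; rewrite /l mem_set//.
by have [] := @geometric_cvg _ _ _ _ (fun n => @step_le p n Gp).
Qed.

Let l_dist p n : G p -> `|l p - u n p| <= 2 * Num.sqrt (k p) * 2^-1 ^+ n.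
Proof.
move=> Gp; rewrite /l mem_set//.
by have [_] := @geometric_cvg _ _ _ _ (fun n => @step_le p n Gp); apply.
Qed.

Let sqr_l_dist p n : G p -> `|l p - u n p| ^+ 2 <= (4 * 2^-1 ^+ n) * k p.
Proof.
move=> Gp; have k0 : 0 <= k p by rewrite fine_ge0.
have h := l_dist n Gp.
have {}h : `|l p - u n p| ^+ 2 <= (2 * Num.sqrt (k p) * 2^-1 ^+ n) ^+ 2.
  by rewrite ler_pXn2r ?nnegrE ?mulr_ge0 ?sqrtr_ge0 ?exprn_ge0.
rewrite (le_trans h)// !exprMn sqr_sqrtr// (_ : 2 ^+ 2 = 4); last by ring.
rewrite mulrAC ler_wpM2r// ler_wpM2l// expr2 ler_piMr ?exprn_ge0//.
by rewrite exprn_ile1// invf_le1// ler1n.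
Qed.

(** Both the approximants and [l] are cut off to 0 outside [G], so that the convergence holds at
    every point and not only almost everywhere. *)
Let ml : measurable_section phi l.
Proof.
move=> m.
apply: (@measurable_fun_cvg _ _ _ _ (fun n p => \1_G p * inner (u n p) (phi m p))).
  by move=> n; apply: measurable_funM; [exact: measurable_indic|exact: divalP].
move=> p _; have [Gp|Gp] := pselect (G p).
  rewrite indicE mem_set//; under eq_fun do rewrite mul1r.
  by apply: inner_cvg; exact: cvg_l.
rewrite indicE memNset//; under eq_fun do rewrite mul0r.
by rewrite /l memNset// inner0l; exact: cvg_cst.
Qed.

Lemma di_geometric_cvg : cvg (u @ \oo).
Proof.
(* The dominating function comes from [|l|^2 <= 2 |u 0|^2 + 2 |l - u 0|^2] and
   [|l - u 0|^2 <= 4 k]. *)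
have gi : mu.-integrable [set: P]
    (EFin \o (fun p => 2 * `|u 0%N p| ^+ 2 + 8 * k p)).
  have i2 := integrableZl measurableT 2 (di_integrable_sqr_norm (u 0%N)).
  have i8 := integrableZl measurableT 8 k_int.
  refine (integrableD measurableT i2 i8).
have [|x xl] := @di_of_section _ _ _ mu _ _ hphi l _ ml gi.
  apply: filterS aeG => p Gp; have := sqr_l_dist 0 Gp.
  rewrite expr0 mulr1 => h.
  have := sqr_ge0 `|(l p - u 0%N p) - u 0%N p|; rewrite (sqr_normB (_ - _)).
  by have := sqr_normD (l p - u 0%N p) (u 0%N p); rewrite subrK; lra.
apply/cvg_ex; exists x.
apply: (@cvg_of_sqr_dist0 _ _ _ _ (4 * \int[mu]_p k p)) => n.
rewrite mulrAC -RintegralZl//.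
apply: di_sqr_norm_le; first by refine (integrableZl measurableT _ k_int).
apply: filterS3 aeG xl (divalB x (u n)) => p Gp xl ->; rewrite xl.
exact: sqr_l_dist.
Qed.

End geometric_sequence.

(** This makes the direct integral a [hilbertType], so that Riesz representation and the
    surjectivity criterion apply to it. *)
HB.instance Definition _ := Uniform_isComplete.Build X
  (complete_of_geometric di_geometric_cvg).

End direct_integral_complete.

(** * Correspondence between bilinear forms and operators *)

Section form_operator.
Context {R : realType} {U V : preHilbertType R}.
Variables (b : U -> V -> R) (T : U -> V) (T' : V -> U).
Hypotheses (bT : forall w v, inner (T w) v = b w v)
  (bT' : forall w v, inner w (T' v) = b w v).

Lemma form_le (w : U) (v : V) : b w v <= `|T w| * `|v|.
Proof. by rewrite -bT inner_le_norm. Qed.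

(** The form bound is tested at [v = T w]. *)
Lemma form_operator_bounded : bounded_form b ->
  exists2 M, 0 <= M & forall w, `|T w| <= M * `|w|.
Proof.
move=> [M bM]; exists `|M| => // w.
have [->|Tw0] := eqVneq (T w) 0; first by rewrite normr0 mulr_ge0.
rewrite -(@ler_pM2r _ `|T w|) ?normr_gt0// -expr2 -inner_normE bT -mulrA.
rewrite (le_trans (ler_norm _))// (le_trans (bM _ _))//.
by rewrite ler_wpM2r ?mulr_ge0// ler_norm.
Qed.

(** For [T w] nonzero, the choice [v = T w] gives the quotient [|T w| / |w|], which by
    Cauchy-Schwarz is the largest over all [v]. *)
Lemma sup_sup_leP (C : R) : 0 <= C ->
  (sup_sup b <= C%:E)%E <-> forall w, `|T w| <= C * `|w|.
Proof.
move=> C0; split=> [bC w|TC].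
  have [->|Tw0] := eqVneq (T w) 0; first by rewrite normr0 mulr_ge0.
  (* [T] is not assumed linear; that it maps 0 to 0 is read off from [T']. *)
  have w0 : w != 0.
    apply: contraNneq Tw0 => w0; rewrite -normr_eq0 -sqrf_eq0 -inner_normE bT.
    by rewrite -bT' w0 inner0l.
  have h : ((b w (T w) / (`|w| * `|T w|))%:E <= C%:E)%E.
    apply: le_trans bC; apply: (@le_trans _ _ (ereal_sup (quotients_at b w))).
      by apply: ereal_sup_ubound; exists (T w).
    by apply: ereal_sup_ubound; exists w.
  move: h; rewrite lee_fin -bT inner_normE ler_pdivrMr ?mulr_gt0 ?normr_gt0//.
  by rewrite mulrA expr2 ler_pM2r ?normr_gt0.
apply: ge_ereal_sup => _ [w w0 <-]; apply: ge_ereal_sup => _ [v v0 <-].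
rewrite lee_fin ler_pdivrMr ?mulr_gt0 ?normr_gt0// (le_trans (form_le _ _))//.
by rewrite mulrA ler_wpM2r.
Qed.

(** For [T w] nonzero the inner supremum is [|T w| / |w|]. Zero spaces fit the conventions: if [U]
    is zero, the infimum is [+oo] and the lower bound is trivial; if only [V] is zero, the suprema
    are [-oo] and [T w = 0] violates the bound. *)
Lemma inf_sup_geP (c : R) : 0 < c ->
  (c%:E <= inf_sup b)%E <-> forall w, c * `|w| <= `|T w|.
Proof.
move=> c0; split=> [bc w|Tc].
  have [->|w0] := eqVneq w 0; first by rewrite normr0 mulr0.
  rewrite -ler_pdivlMr ?normr_gt0// -lee_fin (le_trans bc)//.
  apply: (@le_trans _ _ (ereal_sup (quotients_at b w))).
    by apply: ereal_inf_lbound; exists w.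
  apply: ge_ereal_sup => _ [v v0 <-].
  rewrite lee_fin ler_pdivrMr ?mulr_gt0 ?normr_gt0// (le_trans (form_le _ _))//.
  by rewrite mulrA divfK ?normr_eq0.
apply: le_ereal_inf_tmp => _ [w w0 <-].
have Tw0 : 0 < `|T w| by rewrite (lt_le_trans _ (Tc w))// mulr_gt0// normr_gt0.
apply: (@le_trans _ _ (b w (T w) / (`|w| * `|T w|))%:E).
  rewrite lee_fin ler_pdivlMr ?mulr_gt0 ?normr_gt0// -?normr_gt0//.
  by rewrite -bT inner_normE mulrA expr2 ler_wpM2r.
by apply: ereal_sup_ubound; exists (T w) => //=; rewrite -normr_gt0.
Qed.

(** The witness is [w = T' v], for which [b w v] equals [|T' v|^2]. *)
Lemma right_nondegenerateP :
  right_nondegenerate b <-> forall v, T' v = 0 -> v = 0.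
Proof.
split=> [nd v T'v|T'0 v v0].
  apply/eqP/negP => /negP/nd[w]; rewrite -bT' T'v inner0r.
  by rewrite eqxx.
exists (T' v); rewrite -bT' inner_normE sqrf_eq0 normr_eq0.
by apply: contraNneq v0 => /T'0 ->.
Qed.

Lemma adjoint_bounded (C : R) : 0 <= C -> (forall w, `|T w| <= C * `|w|) ->
  forall v, `|T' v| <= C * `|v|.
Proof.
move=> C0 TC v; have [->|T'v0] := eqVneq (T' v) 0.
  by rewrite normr0 mulr_ge0.
rewrite -(@ler_pM2l _ `|T' v|) ?normr_gt0// -expr2 -inner_normE bT'.
by rewrite (le_trans (form_le _ _))// mulrA ler_wpM2r// mulrC TC.
Qed.

End form_operator.

Lemma bounded_form_operator (R : realType) (U V : hilbertType R)
    (b : {bilinear U -> V -> R | *%R & *%R}) : bounded_form b ->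
  exists (T : U -> V) (T' : V -> U),
    (forall w v, inner (T w) v = b w v) /\ (forall w v, inner w (T' v) = b w v).
Proof.
move=> [M bM].
have /choice[T hT] : forall w, exists t, forall v, inner t v = b w v.
  move=> w; apply: (@riesz_representation _ _ _ (M * `|w|)) => [u v|k u|u].
  - by rewrite linearDr.
  - by rewrite linearZr_LR.
  - by rewrite -mulrA.
have /choice[T' hT'] : forall v, exists t, forall w, inner t w = b w v.
  move=> v; apply: (@riesz_representation _ _ _ (M * `|v|)) => [u w|k u|u].
  - by rewrite linearDl.
  - by rewrite linearZl_LR.
  - by rewrite -mulrA [`|v| * _]mulrC.
by exists T, T'; split=> // w v; rewrite innerC.
Qed.

(** * Isomorphisms onto the dual *)

Section inner_dual.
Context {R : realType} {Y : preHilbertType R}.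
Variable y : Y.

Let inner_linear : linear (inner y : Y -> R^o).
Proof. by move=> k u v; rewrite innerDr innerZr. Qed.

Let inner_map : {linear Y -> R^o} := HB.pack (inner y : Y -> R^o)
  (GRing.isLinear.Build _ _ _ _ _ inner_linear).

Let inner_continuous : continuous inner_map.
Proof.
apply/linear_bounded_continuous/linear_boundedP.
exists `|y|; split; first exact: num_real.
by move=> r /ltW yr x; rewrite (le_trans (cauchy_schwarz _ _))// ler_wpM2r.
Qed.

Definition inner_dual : dual Y := Dual inner_continuous.

Lemma inner_dual_le : `|inner_dual| <= `|y|.
Proof. by apply: dual_norm_le => // v; exact: cauchy_schwarz. Qed.

End inner_dual.

(** [B w] is the functional [inner (T w)], and [S f] is a preimage under [T] of the Riesz
    representative of [f]. The lower bound on [T] gives injectivity and [|S f| <= c^-1 |f|]. *)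
Lemma dual_isomorphism (R : realType) (X Y : hilbertType R) (T : {linear X -> Y})
    (c C : R) :
  0 < c -> (forall w, c * `|w| <= `|T w|) -> (forall w, `|T w| <= C * `|w|) ->
  (forall y, exists w, T w = y) ->
  exists B : {linear X -> dual Y}, [/\ forall w v, B w v = inner (T w) v,
    bounded_operator B & exists S : dual Y -> X,
      [/\ cancel B S, cancel S B & bounded_operator S]].
Proof.
move=> c0 cT TC surT.
pose B0 w : dual Y := inner_dual (T w).
have B0_lin : linear B0.
  move=> k u v; apply: dual_eq => y /=.
  by rewrite linearD linearZ innerDl innerZl.
pose B : {linear X -> dual Y} := HB.pack B0
  (GRing.isLinear.Build _ _ _ _ _ B0_lin).
have /choice[S hS] : forall f : dual Y, exists w, forall v, inner (T w) v = f v.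
  move=> f; have [|||y hy] := @riesz_representation _ Y f (dual_norm f).
  - by move=> u v; rewrite linearD.
  - by move=> k u; rewrite linearZ.
  - exact: le_dual_norm.
  - by have [w wy] := surT y; exists w; rewrite wy.
have BS : cancel S B by move=> f; apply: dual_eq => v; exact: hS.
exists B; split=> //.
  exists `|C| => w; apply: dual_norm_le => [|v]; first by rewrite mulr_ge0.
  rewrite (le_trans (cauchy_schwarz _ _))// ler_wpM2r// (le_trans (TC w))//.
  by rewrite ler_wpM2r// ler_norm.
exists S; split=> // [w|].
  apply/eqP; rewrite -subr_eq0 -normr_le0 -(pmulr_rle0 _ c0) (le_trans (cT _))//.
  rewrite normr_le0 linearB subr_eq0; apply/eqP/inner_inj => v.
  by rewrite hS.
exists c^-1 => f; rewrite mulrC ler_pdivlMr// mulrC (le_trans (cT _))//.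
have [->|TSf0] := eqVneq (T (S f)) 0; first by rewrite normr0.
rewrite -(@ler_pM2r _ `|T (S f)|) ?normr_gt0// -expr2 -inner_normE hS.
by rewrite (le_trans (ler_norm _))// le_dual_norm.
Qed.

(** Upper and lower bounds are both brought to the form [0 <= al |w|^2 + be |v|^2], which is
    additive under integration, so that one argument treats both. *)
Lemma ler_norm_sqr (R : realType) (U V : normedModType R) (C : R) (w : U) (v : V) :
  0 <= C -> (`|v| <= C * `|w|) = (0 <= C ^+ 2 * `|w| ^+ 2 + -1 * `|v| ^+ 2).
Proof.
move=> C0; rewrite mulN1r subr_ge0 -exprMn ler_pXn2r ?nnegrE//.
by rewrite mulr_ge0.
Qed.

Lemma ger_norm_sqr (R : realType) (U V : normedModType R) (c : R) (w : U) (v : V) :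
  0 <= c -> (c * `|w| <= `|v|) = (0 <= - c ^+ 2 * `|w| ^+ 2 + 1 * `|v| ^+ 2).
Proof.
move=> c0; rewrite mul1r mulNr addrC subr_ge0 -exprMn ler_pXn2r ?nnegrE//.
by rewrite mulr_ge0.
Qed.

(** * Density of rational combinations *)

Section rational_combinations.
Context {R : realType} {W : hilbertType R} (e : nat -> W).

(** Lists of rationals are countable, so null sets that depend on the list can be united. *)
Definition rat_comb (s : seq rat) : W := \sum_(i < size s) ratr s`_i *: e i.

Lemma rat_comb_rcons s q :
  rat_comb (rcons s q) = rat_comb s + ratr q *: e (size s).
Proof.
rewrite /rat_comb size_rcons big_ord_recr/= nth_rcons ltnn eqxx.
by congr +%R; apply: eq_bigr => i _; rewrite nth_rcons ltn_ord.
Qed.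

(** Coefficients are approximated one at a time. The length of [s] is kept equal to [n] so that the
    appended coefficient multiplies [e n]. *)
Lemma rat_comb_approx (n : nat) (a : nat -> R) (eps : R) : 0 < eps ->
  exists2 s, size s = n & `|\sum_(i < n) a i *: e i - rat_comb s| < eps.
Proof.
elim: n eps => [|n ih] eps eps0.
  by exists [::] => //; rewrite /rat_comb/= !big_ord0 subrr normr0.
have eps20 : 0 < eps / 2 by rewrite divr_gt0.
have [s sn hs] := ih _ eps20.
have [q hq] : exists q : rat, `|a n - ratr q| < eps / 2 / (1 + `|e n|).
  have [x [+ [q _ qx]]] :
      ball (a n) (eps / 2 / (1 + `|e n|)) `&` range (@ratr R) !=set0.
    apply: dense_rat; last exact: ball_open.
    by exists (a n); apply: ballxx; rewrite divr_gt0// ltr_pwDl.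
  by rewrite -ball_normE/= => h; exists q; rewrite qx.
exists (rcons s q); first by rewrite size_rcons sn.
rewrite rat_comb_rcons big_ord_recr/= sn opprD addrACA -scalerBl.
rewrite (le_lt_trans (ler_normD _ _))// (splitr eps) ltr_leD// normrZ.
move: hq; rewrite ltr_pdivlMr ?ltr_pwDl// => /ltW; apply: le_trans.
by rewrite mulrDr mulr1 lerDr.
Qed.

Lemma rat_comb_dense : dense (lin_span e) ->
  forall (x : W) (eps : R), 0 < eps -> exists s, `|x - rat_comb s| < eps.
Proof.
move=> dW x eps eps0; have eps20 : 0 < eps / 2 by rewrite divr_gt0.
have [y [xy [n [a ya]]]] : ball x (eps / 2) `&` lin_span e !=set0.
  by apply: dW; [exists x; exact: ballxx|exact: ball_open].
have [s _ hs] := rat_comb_approx n a eps20.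
exists s; rewrite -(subrKA y) (le_lt_trans (ler_normD _ _))//.
rewrite (splitr eps) ltrD//; first by move: xy; rewrite -ball_normE.
by rewrite ya.
Qed.

End rational_combinations.

(** * Measurable fields of operators and the passage between fibres and integrals *)

Section fields_of_operators.
Context {d : measure_display} {P : measurableType d} {R : realType}.
Variable mu : probability P R.
Context {U V : P -> hilbertType R}.
Context {phi : nat -> forall p, U p} {psi : nat -> forall p, V p}.
Hypotheses (hphi : fundamental_sequence phi) (hpsi : fundamental_sequence psi).
Variables (T : forall p, U p -> V p) (T' : forall p, V p -> U p).
#[local] Arguments T : clear implicits.
#[local] Arguments T' : clear implicits.
Hypothesis adj : forall p w v, inner (T p w) v = inner w (T' p v).
Hypothesis measurable_entries : forall n m,
  measurable_fun [set: P] (fun p => inner (T p (phi n p)) (psi m p)).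
Local Notation X := (directIntegral mu hphi).
Local Notation Y := (directIntegral mu hpsi).

(** Linearity is a consequence of having an adjoint. *)
Lemma fieldD p (w w' : U p) : T p (w + w') = T p w + T p w'.
Proof. by apply: inner_inj => v; rewrite innerDl !adj innerDl. Qed.

Lemma fieldZ p (k : R) (w : U p) : T p (k *: w) = k *: T p w.
Proof. by apply: inner_inj => v; rewrite innerZl !adj innerZl. Qed.

(** The adjoint moves onto [psi m], and [T' p (psi m p)] is a measurable section because its
    products with [phi n p] are the given entries. *)
Lemma measurable_field (w : forall p, U p) : measurable_section phi w ->
  measurable_section psi (fun p => T p (w p)).
Proof.
move=> mw m; under eq_fun do rewrite adj.
apply: (measurable_inner_section hphi) => // n.
by under eq_fun do rewrite innerC -adj; exact: measurable_entries.
Qed.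

Lemma measurable_rat_comb (s : seq rat) :
  measurable_section phi (fun p => rat_comb (fun n => phi n p) s).
Proof.
move=> n; under eq_fun do rewrite inner_suml.
apply: measurable_sum => i; under eq_fun do rewrite innerZl.
by apply: measurable_funM; [exact: measurable_cst|exact: hphi.1].
Qed.

(* Localization: test the integrated inequality on w restricted to the set
   where the pointwise one fails, scaled down to be square integrable. *)
Lemma ae_ge0_of_integral (al be : R) :
  (forall (x : X) (y : Y), {ae mu, forall p, y p = T p (x p)} ->
     0 <= al * `|x| ^+ 2 + be * `|y| ^+ 2) ->
  forall w : forall p, U p, measurable_section phi w ->
  {ae mu, forall p, 0 <= al * `|w p| ^+ 2 + be * `|T p (w p)| ^+ 2}.
Proof.
move=> H w mw; have mTw := measurable_field mw.
pose s p := `|w p| ^+ 2; pose t p := `|T p (w p)| ^+ 2.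
have ms : measurable_fun [set: P] s by exact: (measurable_sqr_norm hphi).
have mt : measurable_fun [set: P] t by exact: (measurable_sqr_norm hpsi).
pose F p := al * s p + be * t p.
have mF : measurable_fun [set: P] F.
  by apply: measurable_funD; apply: measurable_funM => //; exact: measurable_cst.
pose A := [set p | F p < 0].
have mA : measurable A.
  have -> : A = [set: P] `&` F @^-1` `]-oo, 0[.
    by rewrite setTI; apply/seteqP; split => p; rewrite /= in_itv.
  exact: mF.
(* The indicator localizes to the bad set; the exponential is positive and keeps [r^2 |w|^2] and
   [r^2 |T w|^2] at most 1. *)
pose r p : R := \1_A p * expR (- (s p + t p)).
have st0 p : 0 <= s p + t p by rewrite addr_ge0// sqr_ge0.
have mr : measurable_fun [set: P] r.
  apply: measurable_funM; first exact: measurable_indic.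
  apply: measurableT_comp => //; apply: measurable_funN.
  exact: measurable_funD.
have r_le p z : 0 <= z -> z <= s p + t p -> r p ^+ 2 * z <= 1.
  move=> z0 zD; have e1 := expR_ge1Dx (s p + t p).
  rewrite /r indicE; case: (_ \in _) => /=; last by rewrite mul0r expr0n mul0r.
  rewrite mul1r expr2 -mulrA expRN mulr_ile1 ?invr_ge0 ?mulr_ge0 ?expR_ge0//.
  - by rewrite invf_le1 ?expR_gt0// (le_trans _ e1)// lerDl.
  - by rewrite mulrC ler_pdivrMr ?expR_gt0// mul1r (le_trans zD)// (le_trans _ e1)// lerDr.
have gi : mu.-integrable [set: P] (EFin \o (fun=> 1 : R)).
  exact: finite_measure_integrable_cst.
have [|x xw] := @di_of_section _ _ _ mu _ _ hphi _ _ (measurable_sectionZ mr mw) gi.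
  apply: aeW => p; rewrite normrZ exprMn real_normK ?num_real// r_le ?sqr_ge0//.
  by rewrite lerDl sqr_ge0.
have [|y yTw] := @di_of_section _ _ _ mu _ _ hpsi _ _ (measurable_sectionZ mr mTw) gi.
  apply: aeW => p; rewrite normrZ exprMn real_normK ?num_real// r_le ?sqr_ge0//.
  by rewrite lerDr sqr_ge0.
have yTx : {ae mu, forall p, y p = T p (x p)}.
  by apply: filterS2 xw yTw => p -> ->; rewrite fieldZ.
pose g p := al * `|x p| ^+ 2 + be * `|y p| ^+ 2.
have ix := integrableZl measurableT al (di_integrable_sqr_norm x).
have iy := integrableZl measurableT be (di_integrable_sqr_norm y).
have ig : mu.-integrable [set: P] (EFin \o g).
  by refine (integrableD measurableT ix iy).
have g0 : 0 <= \int[mu]_p g p.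
  by rewrite RintegralD// !RintegralZl ?di_integrable_sqr_norm// -!di_sqr_normE H.
have gE : {ae mu, forall p, g p = r p ^+ 2 * F p}.
  apply: filterS2 xw yTw => p; rewrite /g /F /s /t => -> ->.
  by rewrite !normrZ !exprMn !real_normK ?num_real//; ring.
have rF p : r p ^+ 2 * F p <= 0.
  rewrite /r indicE; have [/set_mem pA|_] := boolP (p \in A).
    by rewrite mulr_ge0_le0 ?sqr_ge0// ltW.
  by rewrite mul0r expr0n mul0r.
have mg : measurable_fun [set: P] (EFin \o g) by exact: measurable_int ig.
(* The integral of [g] is nonnegative while [g = r^2 F <= 0] almost everywhere, so [g] vanishes
   almost everywhere; on [A], however, [r^2 F] is negative. *)
have : (\int[mu]_p `|(EFin \o g) p| = 0)%E.
  apply/eqP; rewrite eq_le integral_ge0 ?andbT//.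
  rewrite (@ae_eq_integral _ _ _ _ _ (fun p => (-1)%:E * (EFin \o g) p)%E)//.
  - rewrite integralZl// -(fineK (integrable_fin_num measurableT ig)) -EFinM.
    by rewrite lee_fin mulN1r oppr_le0.
  - exact: measurableT_comp.
  - exact: measurable_funeM.
  - by apply: filterS gE => p gp _ /=; rewrite gp ler0_norm// -EFinM mulN1r.
move/(ae_eq_integral_abs _ measurableT mg).
apply: filterS2 gE => p gp /(_ I) [g0p]; rewrite leNgt; apply/negP => Fp.
have : r p ^+ 2 * F p < 0.
  rewrite pmulr_rlt0// exprn_gt0// /r indicE mem_set//.
  by rewrite mul1r expR_gt0.
by rewrite -gp g0p ltxx.
Qed.

(** Outside one null set the inequality holds for all rational combinations; continuity of [T p]
    extends it to every vector of the fibre. The bound [M] may depend on [p]. *)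
Lemma ae_field_ge0 (al be : R) :
  (forall p, exists M, forall w, `|T p w| <= M * `|w|) ->
  (forall (x : X) (y : Y), {ae mu, forall p, y p = T p (x p)} ->
     0 <= al * `|x| ^+ 2 + be * `|y| ^+ 2) ->
  {ae mu, forall p, forall w : U p, 0 <= al * `|w| ^+ 2 + be * `|T p w| ^+ 2}.
Proof.
move=> bT H.
have : {ae mu, forall p, forall n, 0 <=
    al * `|rat_comb (fun n => phi n p) (odflt [::] (unpickle n))| ^+ 2 +
    be * `|T p (rat_comb (fun n => phi n p) (odflt [::] (unpickle n)))| ^+ 2}.
  apply: ae_foralln => n; apply: ae_ge0_of_integral => //.
  exact: measurable_rat_comb.
apply: filterS => p Hp w.
have {}Hp s : 0 <= al * `|rat_comb (fun n => phi n p) s| ^+ 2 +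
    be * `|T p (rat_comb (fun n => phi n p) s)| ^+ 2.
  by have := Hp (pickle s); rewrite pickleK.
have /choice[s hs] n : exists s, `|w - rat_comb (fun n => phi n p) s| < 2^-1 ^+ n.
  by apply: rat_comb_dense; [exact: hphi.2|rewrite exprn_gt0].
have hs2 n : `|w - rat_comb (fun n => phi n p) (s n)| ^+ 2 <= 1 * 2^-1 ^+ n.
  rewrite mul1r (@le_trans _ _ ((2^-1 ^+ n) ^+ 2))//.
    by rewrite ler_pXn2r ?nnegrE ?exprn_ge0// ltW.
  by rewrite expr2 ler_piMr ?exprn_ge0// exprn_ile1// invf_le1// ler1n.
have c1 := cvg_of_sqr_dist0 hs2.
have [M hM] := bT p.
have TN (z : U p) : T p (- z) = - T p z by rewrite -scaleN1r fieldZ scaleN1r.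
have c2 : (fun n => T p (rat_comb (fun n => phi n p) (s n))) @ \oo --> T p w.
  apply: (@cvg_of_sqr_dist0 _ _ _ _ (`|M| ^+ 2)) => n.
  rewrite -TN -fieldD (@le_trans _ _ ((`|M| * `|w - rat_comb (phi^~ p) (s n)|) ^+ 2))//.
    rewrite ler_pXn2r ?nnegrE ?mulr_ge0// (le_trans (hM _))//.
    by rewrite ler_wpM2r// ler_norm.
  by rewrite exprMn ler_wpM2l ?sqr_ge0// -[leRHS]mul1r.
have c : (fun n => al * `|rat_comb (fun n => phi n p) (s n)| ^+ 2 +
    be * `|T p (rat_comb (fun n => phi n p) (s n))| ^+ 2) @ \oo -->
    al * `|w| ^+ 2 + be * `|T p w| ^+ 2.
  by apply: cvgD; apply: cvgMr; apply: cvgM; exact: cvg_norm.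
by rewrite -(cvg_lim _ c)//; apply: limr_ge;
  [apply/cvg_ex; eexists; exact: c|exact: nearW].
Qed.

Lemma ae_field_integrable (x : X) (y v : Y) : {ae mu, forall p, y p = T p (x p)} ->
  mu.-integrable [set: P] (fun p => (inner (T p (x p)) (v p))%:E).
Proof.
move=> yTx.
have m1 : measurable_fun [set: P] (fun p => (inner (T p (x p)) (v p))%:E).
  apply/measurable_EFinP/(measurable_inner_section hpsi); last exact: divalP.
  by apply: measurable_field; exact: divalP.
have /integrableP[m2 fin] := integrable_inner y v.
apply/integrableP; split => //; apply: le_lt_trans fin.
rewrite le_eqVlt; apply/orP; left; apply/eqP; apply: ae_eq_integral => //.
- exact: measurableT_comp.
- exact: measurableT_comp.
- by apply: filterS yTx => p <-.
Qed.

Lemma ae_field_inner (x : X) (y v : Y) : {ae mu, forall p, y p = T p (x p)} ->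
  inner y v = \int[mu]_p inner (T p (x p)) (v p).
Proof.
move=> yTx; rewrite directIntegral_innerE; congr fine.
apply: ae_eq_integral => //.
- exact: measurable_int (integrable_inner y v).
- exact: measurable_int (ae_field_integrable v yTx).
- by apply: filterS yTx => p <-.
Qed.

(** Images are chosen one [x] at a time and known only almost everywhere; linearity is still exact
    because elements that agree almost everywhere are equal. *)
Lemma di_operator (C : R) : {ae mu, forall p, forall w, `|T p w| <= C * `|w|} ->
  exists Tg : {linear X -> Y}, forall x : X, {ae mu, forall p, (Tg x : Y) p = T p (x p)}.
Proof.
move=> TC.
have /choice[f hf] (x : X) : exists y : Y, {ae mu, forall p, y p = T p (x p)}.
  have gi := integrableZl measurableT (C ^+ 2) (di_integrable_sqr_norm x).
  apply: (@di_of_section _ _ _ mu _ _ hpsi _ (fun p => C ^+ 2 * `|x p| ^+ 2)).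
  - by apply: measurable_field; exact: divalP.
  - exact: gi.
  - apply: filterS TC => p /(_ (x p)) h; rewrite -exprMn ler_pXn2r ?nnegrE//.
    exact: le_trans h.
have f_lin : linear f.
  move=> k x x'; apply: dival_ae.
  apply: filterS3 (filterI (hf (k *: x + x')) (divalD (k *: f x) (f x')))
    (filterI (divalD (k *: x) x') (divalZ k (f x)))
    (filterI (divalZ k x) (filterI (hf x) (hf x'))).
  by move=> p [-> ->] [-> ->] [-> [-> ->]]; rewrite fieldD fieldZ.
exists (HB.pack f (GRing.isLinear.Build _ _ _ _ _ f_lin) : {linear X -> Y}).
exact: hf.
Qed.

(** Converse of [ae_field_ge0]: the pointwise inequality is applied to [x p] and integrated. *)
Lemma integral_ge0_of_ae (al be : R) (x : X) (y : Y) :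
  {ae mu, forall p, y p = T p (x p)} ->
  {ae mu, forall p, forall w, 0 <= al * `|w| ^+ 2 + be * `|T p w| ^+ 2} ->
  0 <= al * `|x| ^+ 2 + be * `|y| ^+ 2.
Proof.
move=> yTx T0.
have ix := integrableZl measurableT al (di_integrable_sqr_norm x).
have iy := integrableZl measurableT be (di_integrable_sqr_norm y).
rewrite !di_sqr_normE -!RintegralZl ?di_integrable_sqr_norm// -RintegralD//.
have {1}<- : \int[mu]_(p in [set: P]) (0 : R) = 0 by rewrite Rintegral_cst// mul0r.
apply: ae_le_Rintegral.
- exact: integrable0.
- by refine (integrableD measurableT ix iy).
- by apply: filterS2 yTx T0 => p ->; apply.
Qed.

End fields_of_operators.

(** * Norm bounds extracted from a global isomorphism *)

(** Elements [y] representing [b w] stand in for an operator from [X] to [Y], which is not yet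
    available when these bounds are applied. The last bound is the one for the adjoint. *)
Lemma isomorphism_bounds (R : realType) (X Y : preHilbertType R)
    (b : X -> Y -> R) (B : {linear X -> dual Y}) (S : dual Y -> X) :
  (forall w v, B w v = b w v) -> bounded_operator B ->
  cancel B S -> cancel S B -> bounded_operator S ->
  exists M K, [/\ 0 < M, 0 < K,
    forall w y, (forall v, inner y v = b w v) -> `|y| <= M * `|w|,
    forall w y, (forall v, inner y v = b w v) -> K * `|w| <= `|y| &
    forall v x, (forall w, inner w x = b w v) -> K * `|v| <= `|x| ].
Proof.
move=> hB [M0 BM] BS SB [K0 SK].
(* The given constants may be zero or negative; these are positive. *)
pose M := `|M0| + 1; pose K := `|K0| + 1.
have M_gt0 : 0 < M by rewrite ltr_wpDl.
have K_gt0 : 0 < K by rewrite ltr_wpDl.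
have {}BM w : `|B w| <= M * `|w|.
  by rewrite (le_trans (BM w))// ler_wpM2r// (le_trans (ler_norm _))// lerDl.
have {}SK f : `|S f| <= K * `|f|.
  by rewrite (le_trans (SK f))// ler_wpM2r// (le_trans (ler_norm _))// lerDl.
exists M, K^-1; split=> //.
- by rewrite invr_gt0.
- move=> w y hy; have [->|y0] := eqVneq y 0.
    by rewrite normr0 mulr_ge0// ltW.
  rewrite -(@ler_pM2r _ `|y|) ?normr_gt0// -expr2 -inner_normE hy -hB.
  rewrite (le_trans (ler_norm _))// (le_trans (le_dual_norm _ _))//.
  by apply: ler_wpM2r => //; exact: BM.
- move=> w y hy; rewrite ler_pdivrMl// -{1}(BS w) (le_trans (SK _))// ler_wpM2l//.
    exact: ltW.
  by apply: dual_norm_le => // v; rewrite hB -hy cauchy_schwarz.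
- move=> v x hx; rewrite ler_pdivrMl//.
  have [->|v0] := eqVneq v 0; first by rewrite normr0 mulr_ge0// ltW.
  rewrite -(@ler_pM2r _ `|v|) ?normr_gt0// -expr2 -inner_normE.
  (* The functional [inner v] is [B] of its preimage, so [|v|^2] becomes the product of that
     preimage with [x]. *)
  rewrite -[inner v v]/(inner_dual v v) -(SB (inner_dual v)) hB -hx.
  rewrite (le_trans (inner_le_norm _ _))// mulrAC ler_wpM2r//.
  by rewrite (le_trans (SK _))// ler_wpM2l//; [exact: ltW|exact: inner_dual_le].
Qed.

(** * Transfer between the fibres and the direct integrals *)

Theorem theorem2p10 (R : realType) (d : measure_display)
    (P : measurableType d) (mu : probability P R)
    (U V : P -> hilbertType R)
    (sepU : forall p, separable (U p)) (sepV : forall p, separable (V p))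
    (phi : nat -> forall p, U p) (psi : nat -> forall p, V p)
    (hphi : fundamental_sequence phi) (hpsi : fundamental_sequence psi)
    (b : forall p, {bilinear U p -> V p -> R | *%R & *%R})
    (bounded_b : forall p, bounded_form (b p))
    (measurable_b : forall n m,
       measurable_fun [set: P] (fun p => b p (phi n p) (psi m p))) :
  let X := directIntegral mu hphi in
  let Y := directIntegral mu hpsi in
  let bint : X -> Y -> R := integrated_form b in
  let pointwise_conditions (c C : R) :=
    {ae mu, forall p, [/\ (sup_sup (b p) <= C%:E)%E,
                          (c%:E <= inf_sup (b p))%E &
                          right_nondegenerate (b p)]} in
  (is_isomorphism_to_dual mu hphi hpsi b <->
     exists c C : R, [/\ 0 < c, 0 < C & pointwise_conditions c C]) /\
  (forall c C : R, 0 < c -> 0 < C -> pointwise_conditions c C ->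
     [/\ (sup_sup bint <= C%:E)%E,
         (c%:E <= inf_sup bint)%E &
         right_nondegenerate bint]).
Proof.
move=> X Y bint pointwise_conditions.
(* The operators and adjoints are chosen fibre by fibre, without regard to measurability in [p];
   this is recovered from the entries [b p (phi n p) (psi m p)]. *)
have exT p := cid (bounded_form_operator (bounded_b p)).
pose T p := sval (exT p); have exT' p := cid (svalP (exT p)).
pose T' p := sval (exT' p).
have bT p w v : inner (T p w) v = b p w v by exact: (svalP (exT' p)).1.
have bT' p w v : inner w (T' p v) = b p w v by exact: (svalP (exT' p)).2.
have adj p w v : inner (T p w) v = inner w (T' p v) by rewrite bT bT'.
have adj' p w v : inner (T' p w) v = inner w (T p v).
  by rewrite innerC -adj innerC.
have mT n m : measurable_fun [set: P] (fun p => inner (T p (phi n p)) (psi m p)).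
  by under eq_fun do rewrite bT; exact: measurable_b.
have mT' n m : measurable_fun [set: P] (fun p => inner (T' p (psi n p)) (phi m p)).
  by under eq_fun do rewrite adj' innerC; exact: mT.
have T_bnd p : exists M, forall w, `|T p w| <= M * `|w|.
  by have [M _ hM] := form_operator_bounded (bT p) (bounded_b p); exists M.
have T'_bnd p : exists M, forall w, `|T' p w| <= M * `|w|.
  have [M M0 hM] := form_operator_bounded (bT p) (bounded_b p); exists M.
  exact: (adjoint_bounded (bT p) (bT' p)).
(* Any [y] that is fibrewise the image of [x] represents [bint x], even before a global operator is
   known to exist. *)
have bintE (x : X) (y v : Y) : {ae mu, forall p, dival y p = T p (dival x p)} ->
    inner y v = bint x v.
  move=> yTx; rewrite (ae_field_inner adj mT v yTx).
  by apply: eq_Rintegral => p _; exact: bT.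
have bintE' (v : Y) (x w : X) : {ae mu, forall p, dival x p = T' p (dival v p)} ->
    inner w x = bint w v.
  move=> xTv; rewrite innerC (ae_field_inner adj' mT' w xTv).
  by apply: eq_Rintegral => p _; rewrite adj' innerC bT.
(* One construction serves both the isomorphism and the final claim, which therefore has the same
   [c] and [C]. *)
have ops c C : 0 < c -> 0 < C -> pointwise_conditions c C ->
    exists (Tg : {linear X -> Y}) (Tg' : {linear Y -> X}),
    [/\ (forall x : X, {ae mu, forall p, dival (Tg x : Y) p = T p (dival x p)}),
        (forall w v, inner (Tg w) v = bint w v),
        (forall w v, inner w (Tg' v) = bint w v),
        (forall w, `|Tg w| <= C * `|w|) /\ (forall w, c * `|w| <= `|Tg w|) &
        forall v, Tg' v = 0 -> v = 0].
  move=> c0 C0 pc; have [c0' C0'] := (ltW c0, ltW C0).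
  have TC : {ae mu, forall p, forall w, `|T p w| <= C * `|w|}.
    by apply: filterS pc => p [/(sup_sup_leP (bT p) (bT' p) C0')].
  have T'C : {ae mu, forall p, forall v, `|T' p v| <= C * `|v|}.
    by apply: filterS TC => p; exact: (adjoint_bounded (bT p) (bT' p)).
  have cT : {ae mu, forall p, forall w, c * `|w| <= `|T p w|}.
    by apply: filterS pc => p [_ /(inf_sup_geP (bT p) c0)].
  have T'0 : {ae mu, forall p, forall v, T' p v = 0 -> v = 0}.
    by apply: filterS pc => p [_ _ /(right_nondegenerateP (bT' p))].
  have [Tg hTg] := di_operator hphi hpsi adj mT TC.
  have [Tg' hTg'] := di_operator hpsi hphi adj' mT' T'C.
  exists Tg, Tg'; split=> //.
  - by move=> w v; exact: bintE.
  - by move=> w v; exact: bintE'.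
  - split=> w.
      rewrite ler_norm_sqr//; apply: (integral_ge0_of_ae (hTg w)).
      by apply: filterS TC => p TC v; rewrite -ler_norm_sqr.
    rewrite ger_norm_sqr//; apply: (integral_ge0_of_ae (hTg w)).
    by apply: filterS cT => p cT v; rewrite -ger_norm_sqr.
  (* [T' p (v p)] vanishes almost everywhere, hence so does [v p], as [T' p] has trivial kernel. *)
  - move=> v Tv0; apply: dival_ae.
    apply: filterS3 (filterI T'0 (hTg' v)) (dival0 mu hphi) (dival0 mu hpsi).
    by move=> p [T'p h] h0 ->; apply: T'p; rewrite -h Tv0 h0.
split; [split|].
- move=> [int_b [B [hB bB [S [BS SB bS]]]]].
  have [M [K [M0 K0 hM hK hK']]] := isomorphism_bounds hB bB BS SB bS.
  have [M0' K0'] := (ltW M0, ltW K0).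
  exists K, M; split=> //.
  have TM : {ae mu, forall p, forall w, 0 <= M ^+ 2 * `|w| ^+ 2 + -1 * `|T p w| ^+ 2}.
    apply: (ae_field_ge0 adj mT T_bnd) => x y yTx.
    by rewrite -ler_norm_sqr//; apply: hM => v; exact: bintE.
  have TK : {ae mu, forall p, forall w, 0 <= - K ^+ 2 * `|w| ^+ 2 + 1 * `|T p w| ^+ 2}.
    apply: (ae_field_ge0 adj mT T_bnd) => x y yTx.
    by rewrite -ger_norm_sqr//; apply: hK => v; exact: bintE.
  (* Nondegeneracy itself is not an inequality to localize; the lower bound for the adjoint is, and
     it implies a trivial kernel. *)
  have T'K : {ae mu, forall p, forall w, 0 <= - K ^+ 2 * `|w| ^+ 2 + 1 * `|T' p w| ^+ 2}.
    apply: (ae_field_ge0 adj' mT' T'_bnd) => v x xTv.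
    by rewrite -ger_norm_sqr//; apply: hK' => w; exact: bintE'.
  apply: filterS3 TM TK T'K => p TM TK T'K; split.
  + by apply/(sup_sup_leP (bT p) (bT' p) M0') => w; rewrite ler_norm_sqr.
  + by apply/(inf_sup_geP (bT p) K0) => w; rewrite ger_norm_sqr.
  + apply/(right_nondegenerateP (bT' p)) => v T'v.
    have := T'K v; rewrite -ger_norm_sqr// T'v normr0 pmulr_rle0// normr_le0.
    by move/eqP.
- move=> [c [C [c0 C0 pc]]].
  have [Tg [Tg' [hTg bTg bTg' [TgC cTg] Tg'0]]] := ops _ _ c0 C0 pc.
  split.
    (* Existence of the integral: the integrand agrees almost everywhere with the fibrewise inner
       product of [Tg w] and [v]. *)
    move=> w v; have := ae_field_integrable adj mT v (hTg w).
    by under eq_fun do rewrite bT.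
  have adjg w v : inner (Tg w) v = inner w (Tg' v) by rewrite bTg bTg'.
  have sur := surjective_of_bounded_below c0 cTg TgC adjg Tg'0.
  have [B [hB bB S]] := dual_isomorphism c0 cTg TgC sur.
  by exists B; split=> // w v; rewrite hB bTg.
- move=> c C c0 C0 pc.
  have [Tg [Tg' [hTg bTg bTg' [TgC cTg] Tg'0]]] := ops _ _ c0 C0 pc.
  split.
  + exact/(sup_sup_leP bTg bTg' (ltW C0)).
  + exact/(inf_sup_geP bTg c0).
  + exact/(right_nondegenerateP bTg').
Qed.
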